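(* Suppose a group $G$ has a presentation of the form $\langle \Lambda_0, t_1,\ldots,t_M \mid t_i x_i t_i^{-1}=y_i\ (1\le i\le M)\rangle$ where: (1) $\Lambda_0$ is a finite set and, for each $i$, $x_i,y_i$ are words on $\Lambda_0\cup\{t_1,\ldots,t_{i-1}\}$ (and inverses) not representing the identity; (2) the subgroup $\langle\Lambda_0\rangle_G$ of $G$ generated by $\Lambda_0$ is free with free basis $\Lambda_0$; and (3) for each $i$, the cyclic subgroups $\langle x_i\rangle_G$ and $\langle y_i\rangle_G$ are both undistorted in $G$. Then $\mathrm{CL}_G(n)\simeq n$.
   Context: For a group $G=\langle X\mid R\rangle$ with finite presentation, $|g|$ denotes the word length of $g\in G$ with respect to $X^{\pm1}$. For conjugate $u,v\in G$ put $c(u,v)=\min\{|\gamma| : \gamma u\gamma^{-1}=v\}$. The conjugator length function is $\mathrm{CL}_G(n)=\max c(u,v)$, the maximum being over all conjugate pairs $u,v\in G$ with $|u|+|v|\le n$. For non-decreasing $f,g:\mathbb{N}\to\mathbb{N}$ write $f(n)\preceq g(n)$ if there is $C>0$ with $f(n)\le C g(Cn+C)+Cn+C$ for all $n\in\mathbb{N}$, and $f(n)\simeq g(n)$ if $f\preceq g$ and $g\preceq f$; up to $\simeq$, $\mathrm{CL}_G$ does not depend on the finite presentation. For finitely presented groups $H\le G$, the distortion $\mathrm{Dist}_H^G(n)$ is the largest word length in $H$ (with respect to a finite generating set of $H$) of any $h\in H$ whose word length in $G$ is at most $n$; it is well defined up to $\simeq$. $H$ is undistorted in $G$ if $\mathrm{Dist}_H^G(n)\simeq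 n$. $\langle S\rangle_G$ denotes the subgroup of $G$ generated by $S$. *)

(* Defs.v *)
From mathcomp Require Import all_boot.
From mathcomp Require Import boolp classical_sets.

Set Implicit Arguments.
Unset Strict Implicit.
Unset Printing Implicit Defensive.

(* Least and greatest element of a set of natural numbers. The value 0 returned
   when there is none is never used below: see [is_min_nat_min],
   [is_max_nat_max] and the lemmas [word_lengthP], [distortionP] and
   [conjugator_lengthP]. *)
Definition is_min (A : nat -> Prop) (n : nat) : Prop :=
  A n /\ forall m, A m -> n <= m.

Definition is_max (A : nat -> Prop) (n : nat) : Prop :=
  A n /\ forall m, A m -> m <= n.

Definition nat_min (A : nat -> Prop) : nat := xget 0 (is_min A).

Definition nat_max (A : nat -> Prop) : nat := xget 0 (is_max A).

Lemma is_min_nat_min (A : nat -> Prop) : (exists n, A n) -> is_min A (nat_min A).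
Proof.
move=> [n An]; apply: xgetPex.
have [|m /asboolP Am mmin] := @ex_minnP (fun k => `[< A k >]).
  by exists n; apply/asboolP.
by exists m; split=> // k Ak; apply: mmin; apply/asboolP.
Qed.

Lemma is_max_nat_max (A : nat -> Prop) (b : nat) :
  (exists n, A n) -> (forall n, A n -> n <= b) -> is_max A (nat_max A).
Proof.
move=> [n An] Ab; apply: xgetPex.
have [|k /asboolP /Ab //|m /asboolP Am mmax] :=
  @ex_maxnP (fun k => `[< A k >]) b.
  by exists n; apply/asboolP.
by exists m; split=> // k Ak; apply: mmax; apply/asboolP.
Qed.

Definition preceq (f g : nat -> nat) : Prop :=
  exists C : nat, 0 < C /\ forall n, f n <= C * g (C * n + C) + C * n + C.

Definition simeq (f g : nat -> nat) : Prop := preceq f g /\ preceq g f.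

Local Open Scope group_scope.

(* The letter [(a, false)] stands for a and [(a, true)] for a^-1. *)
Definition word (X : Type) := seq (X * bool).

Definition inv_letter (X : Type) (a : X * bool) : X * bool := (a.1, ~~ a.2).

Definition reduced (X : eqType) (w : word X) : bool :=
  sorted (fun a b => b != inv_letter a) w.

Definition eval (X : Type) (G : groupType) (s : X -> G) (w : word X) : G :=
  \prod_(a <- w) (if a.2 then (s a.1)^-1 else s a.1).

Definition generated (X : Type) (G : groupType) (s : X -> G) (g : G) : Prop :=
  exists w, eval s w = g.

Definition free_basis (X : eqType) (G : groupType) (s : X -> G) : Prop :=
  forall w : word X, reduced w -> w <> [::] -> eval s w <> 1.

(* Equality of words in < X | l_i = r_i (i in I) >: the congruence generated
   by the free cancellations and the relations. *)
Inductive relation_step (X I : Type) (l r : I -> word X) :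
    word X -> word X -> Prop :=
| FreeCancel u a v :
    relation_step l r (u ++ [:: a; inv_letter a] ++ v) (u ++ v)
| ApplyRelation u i v :
    relation_step l r (u ++ l i ++ v) (u ++ r i ++ v).

Inductive presented_eq (X I : Type) (l r : I -> word X) :
    word X -> word X -> Prop :=
| PresStep u v : relation_step l r u v -> presented_eq l r u v
| PresRefl u : presented_eq l r u u
| PresSym u v : presented_eq l r u v -> presented_eq l r v u
| PresTrans u v w :
    presented_eq l r u v -> presented_eq l r v w -> presented_eq l r u w.

Definition has_presentation (X I : Type) (G : groupType) (s : X -> G)
    (l r : I -> word X) : Prop :=
  (forall g, generated s g) /\
  (forall u v, eval s u = eval s v <-> presented_eq l r u v).

Definition word_length (X : Type) (G : groupType) (s : X -> G) (g : G) : nat :=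
  nat_min (fun k => exists w, eval s w = g /\ size w = k).

(* Distortion in G, generated by [s], of the subgroup H generated by [h]. *)
Definition distortion (X Y : Type) (G : groupType) (s : X -> G) (h : Y -> G)
    (n : nat) : nat :=
  nat_max (fun k => exists g, [/\ generated h g, word_length s g <= n
                                & word_length h g = k]).

Definition undistorted (X Y : Type) (G : groupType) (s : X -> G) (h : Y -> G) :
    Prop :=
  simeq (distortion s h) id.

Definition cyclic_undistorted (X : Type) (G : groupType) (s : X -> G) (g : G) :
    Prop :=
  undistorted s (fun _ : unit => g).

Definition conjugate (G : groupType) (u v : G) : Prop :=
  exists c, c * u * c^-1 = v.

Definition conjugator_dist (X : Type) (G : groupType) (s : X -> G) (u v : G) :
    nat :=
  nat_min (fun k => exists c, c * u * c^-1 = v /\ word_length s c = k).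

Definition conjugator_length (X : Type) (G : groupType) (s : X -> G) (n : nat) :
    nat :=
  nat_max (fun k => exists u v, [/\ conjugate u v,
                                    word_length s u + word_length s v <= n
                                  & conjugator_dist s u v = k]).

Lemma word_lengthP (X : Type) (G : groupType) (s : X -> G) (g : G) :
  generated s g ->
  is_min (fun k => exists w, eval s w = g /\ size w = k) (word_length s g).
Proof. by move=> [w wg]; apply: is_min_nat_min; exists (size w), w. Qed.

Lemma word_length1 (X : Type) (G : groupType) (s : X -> G) :
  word_length s 1 = 0.
Proof.
have s1 : eval s [::] = 1 by rewrite /eval big_nil.
have [_ /(_ 0) min0] := word_lengthP (ex_intro _ [::] s1).
by apply/eqP; rewrite -leqn0; apply: min0; exists [::].
Qed.

Lemma conjugator_distP (X : Type) (G : groupType) (s : X -> G) (u v : G) :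
  conjugate u v ->
  is_min (fun k => exists c, c * u * c^-1 = v /\ word_length s c = k)
         (conjugator_dist s u v).
Proof. by move=> [c cuv]; apply: is_min_nat_min; exists (word_length s c), c. Qed.

Lemma short_word (X : Type) (G : groupType) (s : X -> G) (g : G) (n : nat) :
  generated s g -> word_length s g <= n ->
  exists w : {bseq n of X * bool}, eval s w = g.
Proof.
move=> /word_lengthP [[w [<- wn]] _]; rewrite -wn => wlen.
by exists (Bseq wlen).
Qed.

Lemma distortionP (X : finType) (Y : Type) (G : groupType) (s : X -> G)
    (h : Y -> G) (n : nat) :
  (forall g, generated s g) ->
  is_max (fun k => exists g, [/\ generated h g, word_length s g <= n
                               & word_length h g = k]) (distortion s h n).
Proof.
move=> sG; apply: (@is_max_nat_max _
    (\max_(w : {bseq n of X * bool}) word_length h (eval s w))).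
  exists 0, 1; split; rewrite ?word_length1//.
  by exists [::]; rewrite /eval big_nil.
move=> _ [g [_ gn <-]]; have [w <-] := short_word (sG g) gn.
exact: (leq_bigmax (F := fun w : {bseq n of _} => word_length h (eval s w))).
Qed.

Lemma conjugator_lengthP (X : finType) (G : groupType) (s : X -> G) (n : nat) :
  (forall g, generated s g) ->
  is_max (fun k => exists u v, [/\ conjugate u v,
                                   word_length s u + word_length s v <= n
                                 & conjugator_dist s u v = k])
         (conjugator_length s n).
Proof.
move=> sG; apply: (@is_max_nat_max _
    (\max_(p : {bseq n of X * bool} * {bseq n of X * bool})
       conjugator_dist s (eval s p.1) (eval s p.2))).
  exists (conjugator_dist s 1 1), 1, 1; split; rewrite ?word_length1//.
  by exists 1; rewrite !mul1g invg1.
move=> _ [u [v [_ uvn <-]]].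
have [w <-] := short_word (sG u) (leq_trans (leq_addr _ _) uvn).
have [w' <-] := short_word (sG v) (leq_trans (leq_addl _ _) uvn).
exact: (leq_bigmax (F := fun p : {bseq n of _} * {bseq n of _} =>
  conjugator_dist s (eval s p.1) (eval s p.2)) (w, w')).
Qed.

(* The letters of [w] lie in Lambda_0 and {t_j | j < i}; the index set
   1, ..., M is encoded as 'I_M, the generators being inl a (a in Lambda_0)
   and inr j (for t_(j+1)). *)
Definition word_below (L : Type) (M : nat) (i : 'I_M) (w : word (L + 'I_M)) :
    bool :=
  all (fun a : (L + 'I_M) * bool => if a.1 is inr j then j < i else true) w.

Definition stable_conj (L : Type) (M : nat) (i : 'I_M) (w : word (L + 'I_M)) :
    word (L + 'I_M) :=
  (inr i, false) :: w ++ [:: (inr i, true)].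

(* Main.v *)
(* Treating the letters of L as stable letters with trivial edge groups, G is
   obtained from the trivial group by a tower of HNN extensions whose edge
   groups are trivial or infinite cyclic: by Britton's lemma every stage is
   torsion-free and embeds in G. As the edge groups are undistorted, replacing
   the outermost pinches of a word reduces it at linear cost, so every stage is
   undistorted in G. Linear bounds on conjugators are then proved by induction
   along the tower A < B = <A, t>.

   After a cyclic reduction by a conjugator of linear length, two conjugate
   elements of B are both elliptic or both hyperbolic on the Bass-Serre tree. In
   the elliptic case Collins' lemma connects them by conjugacies in A and by t,
   passing through powers of the edge generators with an exponent controlled by
   their length; a shortest such chain visits at most four powers. In the
   hyperbolic case, matching the two axes conjugates one element to a cyclic
   permutation of the other by a power c^m of an edge generator, and m has to be
   bounded. This is the statement that in a long rectangle x^m h = h' z^m', either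
   m is linearly bounded by |h| + |h'|, or h conjugates a fixed power of x into a
   power of z (for x = z = c one can then reduce m modulo that fixed power). It is
   also proved along the tower. When x and z are elliptic, the rectangle is cut
   into rectangles of A; when they are hyperbolic, their axes share a long segment,
   and two powers with the same translation length differ by an element d fixing
   a long segment. A power of x conjugates d to d or to its inverse because edge
   groups are undistorted; hence either a power of x is conjugate by h' to a power
   of z, or d^r is short for a large r, which is impossible. *)
Require Import Defs.
From mathcomp Require Import all_boot.
From HB Require Import structures.
From mathcomp Require Import boolp zify.

Set Implicit Arguments.
Unset Strict Implicit.
Unset Printing Implicit Defensive.
Local Open Scope group_scope.

Ltac keep_arith := repeat match goal with H : ?T |- _ =>
  let k := type of T in unify k Prop;
  lazymatch T with
  | is_true (leq _ _) => fail
  | @eq nat _ _ => fail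
  | _ => clear H
  end end.

(* [lia] and [nia] become very slow in the presence of boolean hypotheses. *)
Ltac nlia := keep_arith; lia.
Ltac nnia := keep_arith; nia.

(** * Words, subgroups and powers of one element *)

Section Words.
Variables (X : Type) (G : groupType) (s : X -> G).
Implicit Types w : word X.

Definition letter (a : X * bool) : G := if a.2 then (s a.1)^-1 else s a.1.

Lemma eval_nil : eval s [::] = 1.
Proof. by rewrite /eval big_nil. Qed.

Lemma eval_cons a w : eval s (a :: w) = letter a * eval s w.
Proof. by rewrite /eval big_cons. Qed.

Lemma eval_cat u v : eval s (u ++ v) = eval s u * eval s v.
Proof. by rewrite /eval big_cat. Qed.

Lemma eval_seq1 a : eval s [:: a] = letter a.
Proof. by rewrite eval_cons eval_nil mulg1. Qed.

Definition inv_word w : word X := rev [seq inv_letter a | a <- w].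

Lemma eval_inv_word w : eval s (inv_word w) = (eval s w)^-1.
Proof.
rewrite /inv_word; elim: w => [|[a b] w IH]; first by rewrite /= eval_nil invg1.
rewrite map_cons rev_cons -cats1 eval_cat IH eval_seq1 eval_cons invgM.
by case: b; rewrite /letter /= ?invgK.
Qed.

Lemma size_inv_word w : size (inv_word w) = size w.
Proof. by rewrite size_rev size_map. Qed.

End Words.

Section Subgroups.
Variable G : groupType.

Definition subgroup (A : G -> Prop) : Prop :=
  [/\ A 1, forall a b, A a -> A b -> A (a * b) & forall a, A a -> A a^-1].

Lemma generated_subgroup (X : Type) (s : X -> G) : subgroup (generated s).
Proof.
split=> [|_ _ [u <-] [v <-]|_ [u <-]].
- by exists [::]; rewrite eval_nil.
- by exists (u ++ v); rewrite eval_cat.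
- by exists (inv_word u); rewrite eval_inv_word.
Qed.

(** Integer powers are written [sgn b g ^+ n], sign and absolute value apart, because the exponents
    of [^+] are natural numbers. *)
Definition sgn (b : bool) (g : G) : G := if b then g^-1 else g.

Lemma sgnN b g : sgn (~~ b) g = (sgn b g)^-1.
Proof. by case: b; rewrite /= ?invgK. Qed.

Lemma sgn_exp b g n : sgn b g ^+ n = sgn b (g ^+ n).
Proof. by case: b; rewrite /= ?expVgn. Qed.

Definition cyc (g : G) : G -> Prop := generated (fun _ : unit => g).

Lemma cyc_subgroup g : subgroup (cyc g).
Proof. exact: generated_subgroup. Qed.

Lemma cyc_id g : cyc g g.
Proof. by exists [:: (tt, false)]; rewrite eval_seq1. Qed.

End Subgroups.

(** Sign and exponent are computed from the word alone and serve all groups and elements at once;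
    this allows the orders of two edge generators to be compared. *)
Lemma unit_word_exp (w : word unit) : exists b n, n <= size w /\
  forall (G : groupType) (g : G), eval (fun _ => g) w = sgn b g ^+ n.
Proof.
elim: w => [|[[] c] w [b [n [nw wE]]]].
  by exists false, 0; split=> // G g; rewrite eval_nil expg0.
have [<-|nbc] := eqVneq b c.
  by exists b, n.+1; split=> // G g; rewrite eval_cons wE expgS; case: b {wE}.
case: n nw wE => [|n] nw wE.
  exists c, 1%N; split=> // G g.
  by rewrite eval_cons wE expg0 mulg1; case: c {nbc}.
exists b, n; split=> [|G g]; first by apply: leqW; exact: ltnW.
rewrite eval_cons wE expgS.
by move: nbc; case: b {wE}; case: c => //= _; rewrite /letter /= ?mulKg ?mulVKg.
Qed.

Lemma cycP (G : groupType) (g h : G) :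
  cyc g h <-> exists b n, h = sgn b g ^+ n.
Proof.
split=> [[w <-]|[b [n ->]]].
  by have [b [n [_ ->]]] := unit_word_exp w; exists b, n.
exists (nseq n (tt, b)); elim: n => [|n IH]; first by rewrite eval_nil.
by rewrite /= eval_cons IH expgS; case: b {IH}.
Qed.

(** * Forms of elements over a base group and a stable letter *)

Section Forms.
Variables (G : groupType) (t : G).
Implicit Types (l m : seq (bool * G)).

Definition ltr (e : bool) : G := sgn e t.

(** A form is a product [a * ev t l]: the leading base element [a] stays outside the list. *)
Definition ev l : G := \prod_(p <- l) (ltr p.1 * p.2).

Lemma ltrN e : ltr (~~ e) = (ltr e)^-1.
Proof. exact: sgnN. Qed.

Lemma ev_nil : ev [::] = 1.
Proof. by rewrite /ev big_nil. Qed.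

Lemma ev_cons p l : ev (p :: l) = ltr p.1 * p.2 * ev l.
Proof. by rewrite /ev big_cons. Qed.

Lemma ev_cat l m : ev (l ++ m) = ev l * ev m.
Proof. by rewrite /ev big_cat. Qed.

Lemma ev_seq1 p : ev [:: p] = ltr p.1 * p.2.
Proof. by rewrite ev_cons ev_nil mulg1. Qed.

Lemma ev_rcons l p : ev (rcons l p) = ev l * (ltr p.1 * p.2).
Proof. by rewrite -cats1 ev_cat ev_seq1. Qed.

Definition inside (A : G -> Prop) l : bool := all (fun p => `[< A p.2 >]) l.

(** Only [p.2] lies between the two stable letters; hence the last base element of a reduced form
    can be changed freely. *)
Definition nopinch (F : bool -> G -> Prop) (p q : bool * G) : bool :=
  ~~ ((q.1 == ~~ p.1) && `[< F p.1 p.2 >]).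

End Forms.

Arguments ev_cat {G t}.

(* F false is the domain of conjugation by t, F true its image. *)
Definition britton (G : groupType) (A : G -> Prop) (F : bool -> G -> Prop)
    (t : G) : Prop :=
  forall a l, A a -> inside A l -> sorted (nopinch F) l -> l <> [::] ->
  a * ev t l <> 1.

(** * HNN extensions as groups of permutations of normal forms *)

Record symmetry (T : Type) := Symmetry {
  sym_fun : T -> T;
  sym_inv : T -> T;
  sym_funK : cancel sym_fun sym_inv;
  sym_invK : cancel sym_inv sym_fun }.

Section SymmetryGroup.
Variable T : Type.
Implicit Types f g h : symmetry T.

Lemma symmetry_eq f g : sym_fun f =1 sym_fun g -> f = g.
Proof.
case: f g => [f f' fK f'K] [g g' gK g'K] /= /funext fg; subst g.
have f'g' : f' = g' by apply/funext => x; rewrite -{1}(g'K x) fK.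
by subst g'; congr Symmetry; exact: Prop_irrelevance.
Qed.

HB.instance Definition _ := gen_eqMixin (symmetry T).
HB.instance Definition _ := gen_choiceMixin (symmetry T).

Definition symmetry_one := @Symmetry T id id (fun=> erefl) (fun=> erefl).
Definition symmetry_inv f := Symmetry (@sym_invK _ f) (@sym_funK _ f).
Definition symmetry_mul f g :=
  Symmetry (can_comp (@sym_funK _ f) (@sym_funK _ g))
           (can_comp (@sym_invK _ g) (@sym_invK _ f)).

Lemma symmetry_mulA : associative symmetry_mul.
Proof. by move=> f g h; exact: symmetry_eq. Qed.
Lemma symmetry_mul1g : left_id symmetry_one symmetry_mul.
Proof. by move=> f; exact: symmetry_eq. Qed.
Lemma symmetry_mulg1 : right_id symmetry_one symmetry_mul.
Proof. by move=> f; exact: symmetry_eq. Qed.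
Lemma symmetry_mulVg : left_inverse symmetry_one symmetry_inv symmetry_mul.
Proof. by move=> f; apply: symmetry_eq => x; exact: sym_funK. Qed.
Lemma symmetry_mulgV : right_inverse symmetry_one symmetry_inv symmetry_mul.
Proof. by move=> f; apply: symmetry_eq => x; exact: sym_invK. Qed.

HB.instance Definition _ := isGroup.Build (symmetry T) symmetry_mulA
  symmetry_mul1g symmetry_mulg1 symmetry_mulVg symmetry_mulgV.

Lemma sym_funM f g x : sym_fun (f * g) x = sym_fun f (sym_fun g x).
Proof. by []. Qed.

End SymmetryGroup.

Section HNN.
Variables (A : groupType) (F : bool -> A -> Prop) (phi : bool -> A -> A).
Hypothesis Fsub : forall e, subgroup (F e).
Hypothesis phiM : forall e a b,
  F e a -> F e b -> phi e (a * b) = phi e a * phi e b.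
Hypothesis phiF : forall e a, F e a -> F (~~ e) (phi e a).
Hypothesis phiK : forall e a, F e a -> phi (~~ e) (phi e a) = a.

Let F1 e : F e 1. Proof. by case: (Fsub e). Qed.
Let FM e a b : F e a -> F e b -> F e (a * b).
Proof. by case: (Fsub e) => _ + _; apply. Qed.
Let FV e a : F e a -> F e a^-1.
Proof. by case: (Fsub e) => _ _; apply. Qed.

(** Representative of the right coset of [a] modulo [F e]. The subgroup itself is represented by 1,
    and [choose] returns the same element for equal predicates, so the value depends on the coset
    only. *)
Definition coset_rep (e : bool) (a : A) : A :=
  if `[< F e a >] then 1 else choose (fun b => `[< F e (a / b) >]) a.

Lemma coset_rep1 e a : F e a -> coset_rep e a = 1.
Proof. by move=> Fa; rewrite /coset_rep asboolT. Qed.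

Lemma coset_repP e a : F e (a / coset_rep e a).
Proof.
rewrite /coset_rep; case: asboolP => [|_]; first by rewrite invg1 mulg1.
by apply/asboolP/(@chooseP _ (fun b => `[< F e (a / b) >])); apply/asboolP; rewrite mulgV.
Qed.

Lemma coset_repM e f a : F e f -> coset_rep e (f * a) = coset_rep e a.
Proof.
move=> Ff; rewrite /coset_rep.
have -> : `[< F e (f * a) >] = `[< F e a >].
  apply: asbool_equiv_eq; split=> [Ffa|]; last exact: FM.
  by rewrite -[a](mulKg f); apply: FM => //; exact: FV.
case: ifP => // _.
have PQ : (fun b => `[< F e (f * a / b) >]) =1 (fun b => `[< F e (a / b) >]).
  move=> b; apply: asbool_equiv_eq; rewrite -mulgA; split=> [Ffa|]; last exact: FM.
  by rewrite -[a / b](mulKg f); apply: FM => //; exact: FV.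
rewrite (eq_choose PQ); apply: choose_id; apply/asboolP.
  by rewrite invgM mulgA mulgV mul1g; exact: FV.
by rewrite mulgV.
Qed.

Lemma coset_rep_id e a : coset_rep e (coset_rep e a) = coset_rep e a.
Proof.
by rewrite -(coset_repM (coset_rep e a) (coset_repP e a)) mulgVK.
Qed.

Lemma coset_rep_eq1 e a : coset_rep e a = 1 -> F e a.
Proof. by move=> ra; have := coset_repP e a; rewrite ra invg1 mulg1. Qed.

(** Once edge elements are moved to the left across the stable letters, every base element in the
    list is a coset representative, and a pinch can only surround 1. *)
Definition normal (l : seq (bool * A)) : bool :=
  all (fun p => coset_rep p.1 p.2 == p.2) l &&
  sorted (fun p q => ~~ ((q.1 == ~~ p.1) && (p.2 == 1))) l.

Definition nform := {x : A * seq (bool * A) | normal x.2}.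

(** Left multiplication by the stable letter of sign [e]: with [x.1] written as [f * r], [f] in
    [F e], the factor [f] passes to the left as [phi e f]; if [r] is 1 and the next letter is
    opposite, the two letters cancel. *)
Definition shift_fun (e : bool) (x : A * seq (bool * A)) :=
  let r := coset_rep e x.1 in
  let x' := (phi e (x.1 / r), (e, r) :: x.2) in
  if x.2 is q :: l then
    if (q.1 == ~~ e) && (r == 1) then (phi e x.1 * q.2, l) else x'
  else x'.

Lemma shift_normal e x : normal x.2 -> normal (shift_fun e x).2.
Proof.
case: x => [a [|q l]] /=; rewrite /shift_fun /= /normal /=.
  by rewrite coset_rep_id eqxx.
case/andP=> /andP[qr lr] ql; case: ifP => [_|nq] /=.
  by rewrite lr (path_sorted ql).
by rewrite coset_rep_id eqxx qr lr nq ql.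
Qed.

Definition shift e (x : nform) : nform :=
  exist (fun x => normal x.2) _ (shift_normal e (valP x)).

Lemma shiftK e : cancel (shift e) (shift (~~ e)).
Proof.
move=> x; apply: val_inj => /=; case: x => -[a l] /= nl.
rewrite /shift_fun /=; have Fr := coset_repP e a.
have back : let x' := (phi e (a / coset_rep e a), (e, coset_rep e a) :: l) in
   shift_fun (~~ e) x' = (a, l).
  rewrite /shift_fun /= negbK eqxx /= coset_rep1 ?eqxx; last exact: phiF.
  by rewrite phiK // mulgVK.
case: l nl back => [|q l] nl back; first exact: back.
case: ifP => [/andP[/eqP qe /eqP ra]|_]; last exact: back.
have Fa := coset_rep_eq1 ra.
move: nl; rewrite /normal /= => /andP[/andP[/eqP qr lr] ql] /=.
rewrite coset_repM; last exact: phiF.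
rewrite -qe qr.
have phiaK : phi q.1 (phi e a * q.2 / q.2) = a.
  by rewrite mulgK qe phiK.
(* The letters have cancelled. Shifting back restores the removed one, and no second cancellation
   occurs because the list was normal. *)
case: l lr ql {back} => [|p l] lr /=; first by rewrite phiaK -surjective_pairing.
by case/andP=> /negbTE -> _; rewrite phiaK -surjective_pairing.
Qed.

Definition stable_letter : symmetry nform :=
  Symmetry (shiftK false) (shiftK true).

Definition left_mul (a : A) (x : nform) : nform :=
  exist (fun x => normal x.2) (a * (val x).1, (val x).2) (valP x).

Lemma left_mulK a : cancel (left_mul a) (left_mul a^-1).
Proof. by move=> [[b l] nl]; apply: val_inj; rewrite /= mulKg. Qed.

Lemma left_mulVK a : cancel (left_mul a^-1) (left_mul a).
Proof. by move=> [[b l] nl]; apply: val_inj; rewrite /= mulVKg. Qed.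

Definition base_emb (a : A) : symmetry nform :=
  Symmetry (left_mulK a) (left_mulVK a).

Lemma base_embM : {morph base_emb : a b / a * b}.
Proof.
move=> a b; apply: symmetry_eq => -[[c l] nl].
by apply: val_inj; rewrite /= mulgA.
Qed.

Let base : nform := exist (fun x => normal x.2) (1, [::]) isT.

Lemma base_emb_inj : injective base_emb.
Proof.
move=> a b /(congr1 (fun f => (val (sym_fun f base)).1)) /=.
by rewrite !mulg1.
Qed.

Lemma base_emb1 : base_emb 1 = 1.
Proof. by apply: (mulIg (base_emb 1)); rewrite -base_embM !mul1g. Qed.

Lemma sym_fun_ltr e : sym_fun (ltr stable_letter e) = shift e.
Proof. by case: e. Qed.

Lemma stable_letter_conj e a : F e a ->
  ltr stable_letter e * base_emb a = base_emb (phi e a) * ltr stable_letter e.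
Proof.
move=> Fa; apply: symmetry_eq => -[[b l] nl]; rewrite !sym_funM sym_fun_ltr.
apply: val_inj => /=; rewrite /shift_fun /= coset_repM // -mulgA.
have Fb := coset_repP e b.
rewrite (phiM Fa Fb).
case: l nl => [|q l] nl //=.
case: ifP => [/andP[_ /eqP rb]|//] /=.
by rewrite phiM ?mulgA //; exact: coset_rep_eq1.
Qed.

(** The product acts on the trivial normal form; without pinches no stable letter is ever cancelled,
    so the resulting list is not empty, whereas the identity would leave it empty. *)
Lemma hnn_britton (l : seq (bool * A)) a : sorted (nopinch F) l -> l <> [::] ->
  base_emb a * ev stable_letter [seq (p.1, base_emb p.2) | p <- l] <> 1.
Proof.
set ev' := ev _.
have key : forall l p, path (nopinch F) p l ->
    exists f r l', [/\ F (~~ p.1) f, normal ((p.1, r) :: l') &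
      val (sym_fun (ev' [seq (p.1, base_emb p.2) | p <- p :: l]) base) =
      (f, (p.1, r) :: l')].
  move=> {}l; elim: l => [|q l IH] [e b] /=.
    move=> _; rewrite /ev' ev_seq1 !sym_funM sym_fun_ltr /= mulg1 /shift_fun /=.
    exists (phi e (b / coset_rep e b)), (coset_rep e b), [::]; split=> //.
      by apply: phiF; exact: coset_repP.
    by rewrite /normal /= coset_rep_id eqxx.
  case/andP=> pq /IH [f [r [l' [Ff nl' evE]]]] {IH}.
  rewrite /ev' ev_cons !sym_funM sym_fun_ltr /= -/ev'.
  rewrite evE /shift_fun /=.
  (* A cancellation would put [b * f] in [F e]; as [f] lies there too, so would [b], and the first
     two syllables would pinch. *)
  case: ifP => [/andP[/eqP qe /eqP rb]|nq].
    case/negP: pq; rewrite /= qe eqxx /=; apply/asboolP.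
    rewrite -[b](mulgK f); apply: FM; first exact: coset_rep_eq1.
    by apply: FV; rewrite -[e]negbK -qe.
  exists (phi e (b * f / coset_rep e (b * f))), (coset_rep e (b * f)),
    ((q.1, r) :: l'); split=> //; first by apply: phiF; exact: coset_repP.
  by move: nl'; rewrite /normal /= coset_rep_id eqxx nq.
case: l => // p l /key [f [r [l' [_ _ evE]]]] _.
move/(congr1 (fun g => (val (sym_fun g base)).2)).
by rewrite sym_funM /= evE.
Qed.

End HNN.

(** The hypothesis says that [x] and [y] have the same order, in the form needed to send the value
    of a word at [x] to its value at [y]; this is the isomorphism of the edge groups. *)
Lemma hnn_extension (A : groupType) (x y : A) :
  (forall w : word unit, eval (fun _ => x) w = 1 <-> eval (fun _ => y) w = 1) ->
  exists (B : groupType) (f : A -> B) (t : B),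
    [/\ {morph f : a b / a * b}, injective f, t * f x * t^-1 = f y
      & britton (fun b => exists a, b = f a)
          (fun e => cyc (f (if e then y else x))) t].
Proof.
move=> xy; pose c (e : bool) := if e then y else x.
have cE e (u v : word unit) : eval (fun _ => c e) u = eval (fun _ => c e) v ->
    eval (fun _ => c (~~ e)) u = eval (fun _ => c (~~ e)) v.
  move=> uv; apply: divg1_eq; rewrite -eval_inv_word -eval_cat.
  have : eval (fun _ => c e) (u ++ inv_word v) = 1.
    by rewrite eval_cat eval_inv_word uv mulgV.
  by case: e {uv} => /xy.
pose F e := cyc (c e).
(* By [cE] the value does not depend on the word; outside [F e] it is the default 1. *)
have phi_ex : forall ea : bool * A, exists b, forall w : word unit,
    eval (fun _ => c ea.1) w = ea.2 -> b = eval (fun _ => c (~~ ea.1)) w.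
  move=> [e a]; have [[w wa]|nw] := EM (F e a).
    by exists (eval (fun _ => c (~~ e)) w) => w' /= w'a; apply: cE; rewrite wa.
  by exists 1 => w wa; case: nw; exists w.
have [phi phiP] := choice phi_ex.
pose ph e a := phi (e, a).
have phE e (w : word unit) : ph e (eval (fun _ => c e) w) = eval (fun _ => c (~~ e)) w.
  exact: (phiP (e, _)).
have Fsub e : subgroup (F e) by exact: cyc_subgroup.
have phM e a b : F e a -> F e b -> ph e (a * b) = ph e a * ph e b.
  by move=> [u <-] [v <-]; rewrite -eval_cat !phE eval_cat.
have phF e a : F e a -> F (~~ e) (ph e a).
  by move=> [u <-]; rewrite phE; exists u.
have phK e a : F e a -> ph (~~ e) (ph e a) = a.
  by move=> [u <-]; rewrite !phE negbK.
have Fx : F false x by exact: cyc_id.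
have phx : ph false x = y.
  by have := phE false [:: (tt, false)]; rewrite !eval_seq1.
exists (symmetry (nform F)), (base_emb F), (stable_letter Fsub phF phK).
split; [exact: base_embM|exact: base_emb_inj| |].
  have := stable_letter_conj Fsub phM phF phK Fx.
  by rewrite /= phx => ->; rewrite mulgK.
have cyc_emb e a : F e a -> cyc (base_emb F (c e)) (base_emb F a).
  move=> [w <-]; exists w; elim: w => [|[[] b] w IH].
    by rewrite !eval_nil base_emb1.
  rewrite !eval_cons IH base_embM; congr (_ * _); case: b => //=.
  by apply/esym/(mulIg (base_emb F (c e))); rewrite mulVg -base_embM mulVg base_emb1.
move=> _ l [a ->] lA ls lN.
have [m lE] : exists m, l = [seq (p.1, base_emb F p.2) | p <- m].
  elim: l lA {ls lN} => [|[e b] l IH] /=; first by exists [::].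
  by case/andP=> /asboolP [b' ->] /IH [m ->]; exists ((e, b') :: m).
rewrite lE; apply: hnn_britton; last by move=> mN; rewrite lE mN in lN.
move: ls; rewrite lE sorted_map; apply: sub_sorted => p q /=.
rewrite /nopinch /=; apply: contra => /andP[-> /asboolP Fp] /=.
by apply/asboolP; exact: cyc_emb.
Qed.
(** * Reduced forms *)

(** An HNN extension seen inside an ambient group: base and edge groups are predicates on [G],
    because all stages of the tower are treated as subgroups of one group. *)
Record stable_ext (G : groupType) (A : G -> Prop) (F : bool -> G -> Prop)
    (t : G) : Prop := StableExt {
  stable_subgroup : subgroup A;
  stable_edge : forall e, subgroup (F e);
  stable_edge_sub : forall e a, F e a -> A a;
  stable_edge_conj : forall e a, F e a -> F (~~ e) (ltr t e * a / ltr t e);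
  stable_britton : britton A F t }.

Section Britton.
Variables (G : groupType) (A : G -> Prop) (F : bool -> G -> Prop) (t : G).
Hypothesis AFt : stable_ext A F t.

Let Asub := stable_subgroup AFt.
Let Fsub := stable_edge AFt.
Let FA := stable_edge_sub AFt.
Let Fconj := stable_edge_conj AFt.
Let At_britton := stable_britton AFt.

Implicit Types (e : bool) (l m : seq (bool * G)) (p q : bool * G) (a b : G).
Local Notation ev := (ev t).
Local Notation ltr := (ltr t).
Local Notation p0 := (false, 1 : G).

Let A1 : A 1. Proof. by case: Asub. Qed.
Let AM a b : A a -> A b -> A (a * b).
Proof. by case: Asub => _ + _; apply. Qed.
Let AV a : A a -> A a^-1.
Proof. by case: Asub => _ _; apply. Qed.
Let F1 e : F e 1. Proof. by case: (Fsub e). Qed.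
Let FM e a b : F e a -> F e b -> F e (a * b).
Proof. by case: (Fsub e) => _ + _; apply. Qed.
Let FV e a : F e a -> F e a^-1.
Proof. by case: (Fsub e) => _ _; apply. Qed.
Hint Resolve A1 F1 : core.

Let Fconj' e a : F (~~ e) a -> F e ((ltr e)^-1 * a * ltr e).
Proof. by move=> /Fconj; rewrite negbK ltrN invgK. Qed.

Lemma nopinchP p q : reflect (q.1 = ~~ p.1 /\ F p.1 p.2) (~~ nopinch F p q).
Proof.
rewrite /nopinch negbK; apply: (iffP andP) => -[].
  by move=> /eqP ? /asboolP.
by move=> ? ?; split; [apply/eqP | apply/asboolP].
Qed.

Lemma inside_cons p l : inside A (p :: l) <-> A p.2 /\ inside A l.
Proof. by split=> [/andP[/asboolP ? ?]|[? ?]]; [|apply/andP; split; [exact/asboolP|]]. Qed.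

Lemma inside_cat l m : inside A (l ++ m) = inside A l && inside A m.
Proof. exact: all_cat. Qed.

Lemma inside_rcons l p : inside A (rcons l p) <-> A p.2 /\ inside A l.
Proof.
by rewrite /inside all_rcons; split=> [/andP[/asboolP]|[? ?]] //;
  apply/andP; split=> //; exact/asboolP.
Qed.

(* Two reduced forms of one element cross the same edges of the Bass-Serre
   tree. *)
Lemma reduced_eq l m a b : A a -> A b -> inside A l -> inside A m ->
    sorted (nopinch F) l -> sorted (nopinch F) m -> a * ev l = b * ev m ->
  size l = size m /\ forall i, i < size l ->
    (nth p0 l i).1 = (nth p0 m i).1 /\
    F (~~ (nth p0 l i).1) ((b * ev (take i m))^-1 * (a * ev (take i l))).
Proof.
elim: l a b m => [|[e c] l IH] a b m Aa Ab lA mA ls ms abE.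
  case: m mA ms abE => [|q m] // mA ms abE; exfalso.
  apply: (@At_britton (a^-1 * b) (q :: m)) => //; first by apply: AM => //; exact: AV.
  by rewrite -mulgA -abE ev_nil mulg1 mulVg.
have [/= Ac lA'] := (inside_cons _ _).1 lA.
have ls' := path_sorted ls.
have Aab : A (a^-1 * b) by apply: AM => //; exact: AV.
have lE : ev l = c^-1 * ev ((~~ e, a^-1 * b) :: m).
  transitivity (c^-1 * (ltr e)^-1 * a^-1 * (a * ev ((e, c) :: l))).
    by rewrite ev_cons !gnorm.
  by rewrite abE ev_cons /= ltrN !gnorm.
(* If the lengthened form were reduced, then by induction [l] would start with the letter opposite
   to [e] and [c] would be an edge element: a pinch in the given form. Hence [m] starts with the
   letter [e]. *)
have [red|nred] := boolP (sorted (nopinch F) ((~~ e, a^-1 * b) :: m)).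
  have mA' : inside A ((~~ e, a^-1 * b) :: m) by apply/inside_cons.
  have := IH 1 c^-1 _ A1 (AV Ac) lA' mA' ls' red.
  rewrite mul1g => /(_ lE) [sz /(_ 0)]; rewrite sz /= => /(_ isT) [].
  case: l sz {IH lE lA abE ls' lA'} ls => [//|[e' c'] l] _ ls.
  rewrite /= => e'E; rewrite !ev_nil e'E negbK !gnorm => Fc.
  by case/andP: ls => /negP[]; rewrite /= e'E eqxx; exact/asboolP.
case: m mA ms abE lE nred => [|[f d] m] mA ms abE lE //=; rewrite (ms : path _ _ _) andbT.
case/nopinchP=> /=; rewrite negbK => fe Fab; subst f.
have [/= Ad mA'] := (inside_cons _ _).1 mA.
set g := (ltr e)^-1 * (b^-1 * a) * ltr e.
have Fg : F e g by apply/Fconj'; rewrite -[b^-1 * a]invgK invgM invgK; apply: FV.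
have stepE x y : (b * (ltr e * d * x))^-1 * (a * (ltr e * c * y))
    = (d * x)^-1 * (g * c * y) by rewrite /g !gnorm.
have gcE : g * c * ev l = d * ev m.
  apply: (mulgI (d * ev m)^-1); rewrite -stepE mulVg.
  by move: abE; rewrite !ev_cons /= => ->; rewrite mulVg.
have [sz lm] := IH _ _ _ (AM (FA Fg) Ac) Ad lA' mA' ls' (path_sorted ms) gcE.
rewrite /= sz; split=> // -[|i] ilt /=.
  rewrite !ev_nil !mulg1; split=> //.
  by rewrite -[b^-1 * a]invgK invgM invgK; apply: FV.
have [sgnE Fi] := lm i ltac:(by rewrite sz); split=> //.
by rewrite !ev_cons /= stepE.
Qed.

(** * Reduction at linear cost *)

Section Reduce.
Variables (mu : G -> nat) (K : nat).
Hypothesis muM : forall a b, A a -> A b -> mu (a * b) <= mu a + mu b.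

(** Length of a form whose base elements are measured by [mu], which will be the ambient length, the
    length in a stage, or 0. *)
Definition cost l := (\sum_(p <- l) (mu p.2).+1)%N.

Lemma cost_nil : cost [::] = 0.
Proof. by rewrite /cost big_nil. Qed.

Lemma cost_cons p l : cost (p :: l) = (mu p.2).+1 + cost l.
Proof. by rewrite /cost big_cons. Qed.

Lemma cost_cat l m : cost (l ++ m) = cost l + cost m.
Proof. by rewrite /cost big_cat. Qed.

Hypothesis pinch_cost : forall e a l, A a -> inside A l -> F e (a * ev l) ->
  mu (ltr e * (a * ev l) / ltr e) <= K * (mu a + cost l).

(* Scanning from the left, a letter together with the whole subword up to any
   letter pinching with it is replaced by an edge element; as the removed
   subwords are disjoint, the cost grows only linearly. *)
Lemma reduce l a : A a -> inside A l -> exists b m,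
  [/\ A b, inside A m, sorted (nopinch F) m, a * ev l = b * ev m &
   [/\ mu b + cost m <= K.+1 * (mu a + cost l), size m <= size l &
    forall p m', m = p :: m' -> exists l1 c l2,
      l = l1 ++ (p.1, c) :: l2 /\ a * ev l1 = b]].
Proof.
elim: {l}_.+1 {-2}l a (ltnSn (size l)) => // n IH [|[e c] l] a.
  move=> _ Aa _; exists a, [::]; split=> //; split=> //.
  by rewrite cost_nil addn0 leq_pmull.
rewrite ltnS => ln Aa /inside_cons [/= Ac lA].
have [[l1 [d [l2 [lE Fc]]]]|nosplit] := EM (exists l1 d l2,
    l = l1 ++ (~~ e, d) :: l2 /\ F e (c * ev l1)).
  move: lA; rewrite lE inside_cat => /andP[l1A /inside_cons [/= Ad l2A]].
  have [|b [m [Ab mA ms bmE [bmc sz hd]]]] := IH l2 d _ Ad l2A.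
    by move: ln; rewrite lE /= size_cat /=; nlia.
  set g := ltr e * (c * ev l1) / ltr e.
  have Ag : A g by apply: (@FA (~~ e)); exact: Fconj.
  have prefE x : a * ev ((e, c) :: l1 ++ (~~ e, d) :: x) = a * g * (d * ev x).
    by rewrite ev_cons ev_cat ev_cons /= ltrN /g !gnorm.
  exists (a * g * b), m; split=> //; first by apply: AM => //; exact: AM.
    by rewrite prefE bmE !mulgA.
  split; last first.
  - move=> p m' /hd [k1 [k [k2 [-> <-]]]].
    exists ((e, c) :: l1 ++ (~~ e, d) :: k1), k, k2.
    by rewrite prefE /= -catA.
  - by apply: (leq_trans sz); rewrite /= size_cat /=; nlia.
  have gc := pinch_cost Ac l1A Fc.
  have := muM (AM Aa Ag) Ab; have := muM Aa Ag; rewrite -/g in gc.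
  rewrite cost_cons cost_cat cost_cons /=; nnia.
have [|b [m [Ab mA ms bmE [bmc sz hd]]]] := IH l c _ Ac lA; first exact: ln.
exists a, ((e, b) :: m); split=> //; first exact/inside_cons.
- case: m mA ms bmE bmc sz hd => [|[f d] m] //= mA ms bmE bmc sz hd.
  rewrite ms andbT; apply/negP => /andP[/eqP fe /asboolP Fb].
  (* The reduced remainder remembers where its first letter stood in [l], so a pinch with the kept
     letter would be one of the splittings excluded by [nosplit]. *)
  have [l1 [k [l2 [lE l1E]]]] := hd _ _ erefl; case: nosplit.
  by exists l1, k, l2; rewrite lE -fe l1E.
- by rewrite !ev_cons /= -mulgA bmE !mulgA.
split=> //; last by move=> p m' [<- _]; exists [::], c, l; rewrite ev_nil mulg1.
by rewrite !cost_cons /=; nnia.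
Qed.

End Reduce.

(** Reduction with [mu] and [K] equal to 0 gives a reduced form with at most [size m] letters, and
    all reduced forms of an element have equally many. *)
Lemma reduced_size l m a b : A a -> A b -> inside A l -> inside A m ->
  sorted (nopinch F) l -> a * ev l = b * ev m -> size l <= size m.
Proof.
move=> Aa Ab lA mA ls abE.
have [c [k [Ac kA ks bmE [_ km _]]]] :=
  @reduce (fun _ => 0) 0 (fun _ _ _ _ => isT) (fun _ _ _ _ _ _ => isT) _ _ Ab mA.
by have [-> _] := reduced_eq Aa Ac lA kA ls ks (etrans abE bmE).
Qed.

(** * Products of reduced forms *)

Lemma sorted_rcons_nopinch l e a b :
  sorted (nopinch F) (rcons l (e, a)) = sorted (nopinch F) (rcons l (e, b)).
Proof. by case: l => //= p l; rewrite !rcons_path. Qed.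

(* The form (b; m) starts with the first k letters of (1; v); the group element
   following the k-th letter is allowed to differ. *)
Definition agree k (v : seq (bool * G)) b m : Prop :=
  k = 0 \/ [/\ b = 1, k <= size m, take k.-1 m = take k.-1 v &
              forall i, i < k -> (nth p0 m i).1 = (nth p0 v i).1].

Lemma reduced_mulr b m a : A b -> inside A m -> sorted (nopinch F) m -> A a ->
  exists b' m', [/\ A b', inside A m', sorted (nopinch F) m',
    b * ev m * a = b' * ev m' &
    size m' <= size m /\ forall k v, agree k v b m -> agree k v b' m'].
Proof.
case/lastP: m => [|m [e c]] Ab mA ms Aa.
  exists (b * a), [::]; split=> //; [exact: AM|by rewrite ev_nil !mulg1|].
  by split=> // k v [->|[_]]; [left|rewrite leqn0 => /eqP ->; left].
have [/= Ac mA'] := (inside_rcons _ _).1 mA.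
exists b, (rcons m (e, c * a)); split=> //.
- by apply/inside_rcons; split=> //; exact: AM.
- by rewrite (@sorted_rcons_nopinch _ _ _ c).
- by rewrite !ev_rcons /= !mulgA.
split=> [|k v [->|[b1]]]; [by rewrite !size_rcons|by left|].
rewrite !size_rcons => km tk sg; right; split=> //.
- by rewrite size_rcons.
- by rewrite -tk -!cats1 !takel_cat //; nlia.
move=> i ik; rewrite -sg // !nth_rcons; case: ifP => // _; by case: ifP.
Qed.

(** The new stable letter cancels at most the last letter of the form, whence the loss of one in the
    agreement. *)
Lemma reduced_mulr_ltr b m e a :
  A b -> inside A m -> sorted (nopinch F) m -> A a ->
  exists b' m', [/\ A b', inside A m', sorted (nopinch F) m',
    b * ev m * (ltr e * a) = b' * ev m' &
    size m' <= (size m).+1 /\ forall k v, agree k.+1 v b m -> agree k v b' m'].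
Proof.
move=> Ab mA ms Aa; have [nred|red] := boolP (~~ sorted (nopinch F) (rcons m (e, a))).
  case/lastP: m mA ms nred => [|m [f c]] // mA ms nred.
  have [/= Ac mA'] := (inside_rcons _ _).1 mA.
  have ms' : sorted (nopinch F) m.
    by case: m ms {mA mA' nred} => //= p m; rewrite rcons_path => /andP[].
  have [eE Fc] : e = ~~ f /\ F f c.
    apply/(@nopinchP (f, c) (e, a)); apply: contra nred => red.
    case: m ms {mA mA' ms'} => [|p m] ms /=; first by rewrite red.
    by move: ms; rewrite /= !rcons_path last_rcons red => ->.
  have Ag : A (ltr f * c / ltr f * a) by apply: AM => //; exact/FA/Fconj.
  have [b' [m' [Ab' mA2 ms2 eq2 [sz ag]]]] := reduced_mulr Ab mA' ms' Ag.
  exists b', m'; split=> //.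
    by rewrite -eq2 ev_rcons eE /= ltrN !gnorm.
  split=> [|k v ag1]; first by rewrite size_rcons; nlia.
  apply: ag; case: ag1 => // -[b1]; rewrite size_rcons ltnS => km tk sg.
  case: k km tk sg => [|k] km tk sg; [by left | right; split=> //=].
    move: tk; rewrite /= -cats1 takel_cat // => tk.
    have := congr1 (take k) tk; rewrite !take_takel //; nlia.
  by move=> i ik; rewrite -sg ?nth_rcons ?(leq_trans ik km) //; nlia.
move: red; rewrite negbK => red; exists b, (rcons m (e, a)); split=> //.
- exact/inside_rcons.
- by rewrite ev_rcons !mulgA.
split=> [|k v [|[b1 km tk sg]]]; [by rewrite size_rcons|by []|].
case: k km tk sg => [|k] km tk sg; [by left | right; split=> //=].
- by rewrite size_rcons; nlia.
- rewrite -cats1 takel_cat; last nlia.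
  by have := congr1 (take k) tk; rewrite /= !take_takel //; nlia.
- move=> i ik; rewrite nth_rcons ifT ?sg //; nlia.
Qed.

Lemma reduced_mulr_form v d m : inside A v -> sorted (nopinch F) v ->
    A d -> inside A m -> exists b w,
  [/\ A b, inside A w, sorted (nopinch F) w, ev v * (d * ev m) = b * ev w &
    size w <= size v + size m /\ agree (size v - size m) v b w].
Proof.
move=> vA vs Ad; elim/last_ind: m => [|m [e c] IH].
  move=> _; have [b [w [Ab wA ws E [sz ag]]]] := reduced_mulr A1 vA vs Ad.
  exists b, w; split=> //; first by rewrite ev_nil mulg1 -E mul1g.
  rewrite addn0 subn0; split=> //; apply: ag; case: (posnP (size v)) => [->|v0]; first by left.
  by right; split.
case/inside_rcons=> /= Ac /IH [b [w [Ab wA ws E [sz ag]]]].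
have [b' [w' [Ab' wA' ws' E' [sz' ag']]]] := reduced_mulr_ltr e Ab wA ws Ac.
exists b', w'; split=> //.
  by rewrite -E' -E ev_rcons !mulgA.
rewrite size_rcons; split; first nlia.
case: (ltnP (size m) (size v)) => mv; last by left; nlia.
by apply: ag'; have <- : size v - size m = (size v - (size m).+1).+1 by nlia.
Qed.

Lemma reduced_mull_form u d m : inside A u -> sorted (nopinch F) u ->
    A d -> inside A m -> size m <= size u -> exists b w,
  [/\ A b, inside A w, sorted (nopinch F) (w ++ drop (size m) u),
    d * ev m * ev u = b * ev (w ++ drop (size m) u) & size w <= (size m).*2].
Proof.
move=> uA us + + +; elim: m d => [|[e c] m IH] d Ad.
  by exists d, [::]; rewrite drop0 ev_nil mulg1.
case/inside_cons=> /= Ac mA sz; have [b [w [Ab wA ws E sw]]] := IH c Ac mA (ltnW sz).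
(* Each step hands one more letter of [u] over to [w], so that a pinch with the new letter takes
   place inside [w] and the rest of [u] stays literally the same. *)
set q := nth p0 u (size m); have dropE : drop (size m) u = q :: drop (size m).+1 u.
  by rewrite (drop_nth p0).
have Aq : A q.2 by apply/asboolP; have /allP := uA; apply; rewrite mem_nth.
have E2 x : d * (ltr e * c * ev m) * x = d * ltr e * (c * ev m * x).
  by rewrite !gnorm.
rewrite ev_cons /= E2 E dropE -cat_rcons.
rewrite dropE -cat_rcons in ws.
have rA : inside A (rcons w q) by apply/inside_rcons.
have : size (rcons w q) <= (size m).*2.+1 by rewrite size_rcons.
have [[f g] [r rE]] : exists p r, rcons w q = p :: r.
  by case: (w) => [|p r]; do 2!eexists.
move: rA ws; rewrite rE => /inside_cons [/= Ag rA] ws sr.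
have [/(nopinchP (e, b) (f, g)) /= [fe Fb]|np] := boolP (~~ nopinch F (e, b) (f, g)).
  exists (d * (ltr e * b / ltr e * g)), r; split=> //.
  - by apply: AM => //; apply: AM => //; exact/FA/Fconj.
  - exact: (path_sorted ws).
  - by rewrite ev_cons fe ltrN /= !gnorm.
  - by rewrite doubleS; nlia.
rewrite negbK in np; exists d, [:: (e, b), (f, g) & r]; split=> //.
- by apply/inside_cons; split=> //; exact/inside_cons.
- by rewrite /= np.
- by rewrite /= [ev (_ :: _ :: _)]ev_cons /= !mulgA.
Qed.

(* A quadrilateral in the Bass-Serre tree: away from its first and last n edges,
   the translate of the geodesic u by d * ev m follows the geodesic v. *)
Lemma overlap u v d m a k n : inside A u -> sorted (nopinch F) u ->
    inside A v -> sorted (nopinch F) v ->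
    A d -> inside A m -> A a -> inside A k ->
    size m <= n -> size k <= n -> n <= size u ->
    d * ev m * ev u = ev v * (a * ev k) ->
  exists w,
    [/\ w <= size u + n, size u <= w + n, w <= size v + n, size v <= w + n &
     forall i j, i + size u = j + w -> n <= j < size u -> i + n < size v ->
       (nth p0 u j).1 = (nth p0 v i).1 /\
       F (~~ (nth p0 u j).1)
         ((ev (take i v))^-1 * (d * ev m * ev (take j u)))].
Proof.
move=> uA us vA vs Ad mA Aa kA mn kn nu uvE.
have [b [w [Ab wA ws wE wsz]]] := reduced_mull_form uA us Ad mA (leq_trans mn nu).
have [c [r [Ac rA rs rE [rsz ag]]]] := reduced_mulr_form vA vs Aa kA.
have wuA : inside A (w ++ drop (size m) u).
  rewrite inside_cat wA /=; move: uA.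
  by rewrite -{1}(cat_take_drop (size m) u) inside_cat => /andP[].
have [sz edges] := reduced_eq Ab Ac wuA rA ws rs (etrans (esym wE) (etrans uvE rE)).
(* The witness is the common number of letters of both reduced forms; the condition on [i] and [j]
   then aligns letters counted from the right end. *)
move: sz; rewrite size_cat size_drop => sz; exists (size r); split; [nlia|nlia|nlia| |].
  by case: ag => [|[_ ? _ _]]; nlia.
move=> i j ij /andP[nj ju] iv.
case: ag => [|[c1 ksz tk sg]]; first nlia.
have iE : i = size w + (j - size m) by nlia.
have [|sE Fi] := edges i; first by rewrite size_cat size_drop; nlia.
have nthE : nth p0 (w ++ drop (size m) u) i = nth p0 u j.
  by rewrite nth_cat iE ltnNge leq_addr /= addKn nth_drop subnKC //; nlia.
have takeE : b * ev (take i (w ++ drop (size m) u)) = d * ev m * ev (take j u).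
  apply: (mulIg (ev (drop j u))); rewrite -[RHS]mulgA -ev_cat cat_take_drop wE.
  rewrite -mulgA -ev_cat; congr (b * ev _); rewrite iE takeD take_size_cat // drop_size_cat // -catA.
  congr (_ ++ _); rewrite -{2}(cat_take_drop (j - size m) (drop (size m) u)).
  by rewrite drop_drop; congr (_ ++ drop _ _); nlia.
move: sE Fi; rewrite nthE takeE c1 mul1g (sg i); last nlia.
suff -> : take i r = take i v by [].
by have := congr1 (take i) tk; rewrite !take_takel //; nlia.
Qed.

(** * Powers of cyclically reduced forms, and cyclic reduction *)

Definition rep n l := flatten (nseq n l).

Lemma repS n l : rep n.+1 l = l ++ rep n l.
Proof. by []. Qed.

Lemma repD n k l : rep (n + k) l = rep n l ++ rep k l.
Proof. by rewrite /rep nseqD flatten_cat. Qed.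

Lemma size_rep n l : size (rep n l) = (n * size l)%N.
Proof. by elim: n => //= n IH; rewrite repS size_cat IH mulSn. Qed.

Lemma ev_rep n l : ev (rep n l) = ev l ^+ n.
Proof.
by elim: n => [|n IH]; rewrite ?ev_nil ?expg0 // repS ev_cat IH expgS.
Qed.

Lemma inside_rep n l : inside A l -> inside A (rep n l).
Proof. by move=> lA; elim: n => // n IH; rewrite repS inside_cat lA. Qed.

Lemma take_rep n k j l : n * size l + j <= k * size l ->
  take (n * size l + j) (rep k l) = rep n l ++ take j (rep k l).
Proof.
case: (posnP (size l)) => [/size0nil ->|l0 nk].
  by rewrite !muln0 leqn0 add0n => /eqP ->; rewrite !take0 cats0; elim: n.
have kE : k = n + (k - n) by nnia.
rewrite kE {1}repD takeD -size_rep take_size_cat // drop_size_cat //; congr (_ ++ _).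
have -> : n + (k - n) = (k - n) + n by nlia.
by rewrite repD takel_cat // size_rep; nnia.
Qed.

Lemma nth_rep n k j l : n * size l + j < k * size l ->
  nth p0 (rep k l) (n * size l + j) = nth p0 (rep k l) j.
Proof.
move=> nk; have kE : k = n + (k - n) by nnia.
rewrite kE {1}repD nth_cat size_rep ltnNge leq_addr /= addKn.
have -> : n + (k - n) = (k - n) + n by nlia.
by rewrite repD nth_cat size_rep ifT //; nnia.
Qed.

Lemma sorted_rep n l : cycle (nopinch F) l -> sorted (nopinch F) (rep n l).
Proof.
case: l => [|p l]; first by elim: n.
rewrite /= rcons_path => /andP[pl lp].
suff : path (nopinch F) (last p l) (rep n (p :: l)) by exact: path_sorted.
by elim: n => // n IH; rewrite repS /= cat_path lp pl.
Qed.

Lemma cyc_red_exp l n a : inside A l -> cycle (nopinch F) l -> l <> [::] ->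
  A a -> 0 < n -> a * ev l ^+ n <> 1.
Proof.
move=> lA lc lN Aa n0; rewrite -ev_rep; apply: At_britton => //.
- exact: inside_rep.
- exact: sorted_rep.
by case: l n n0 lN {lA lc} => // p l [].
Qed.

Lemma form_mulr a b m : A a -> A b -> inside A m -> exists c k,
  [/\ A c, inside A k, size k = size m & b * ev m * a = c * ev k].
Proof.
case/lastP: m => [|m [e d]] Aa Ab.
  by exists (b * a), [::]; split=> //; [exact: AM|rewrite ev_nil !mulg1].
case/inside_rcons=> Ad mA; exists b, (rcons m (e, d * a)); split=> //.
- by apply/inside_rcons; split=> //; exact: AM.
- by rewrite !size_rcons.
- by rewrite !ev_rcons /= !mulgA.
Qed.

Section CyclicReduction.
Variables (mu : G -> nat) (K : nat).
Hypothesis muM : forall a b, A a -> A b -> mu (a * b) <= mu a + mu b.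
Hypothesis pinch_cost : forall e a l, A a -> inside A l -> F e (a * ev l) ->
  mu (ltr e * (a * ev l) / ltr e) <= K * (mu a + cost mu l).

(* Among the rotations, one reaches the axis (or the fixed vertex) of the
   element in the Bass-Serre tree: each rotation that is not cyclically reduced
   can be rotated further to shorten its reduced form. *)
Lemma cyclic_reduce l : inside A l -> exists i b m,
  [/\ i <= size l, A b, inside A m,
     mu b + cost mu m <= K.+1.*2 * (mu 1 + cost mu l) &
     m = [::] /\ ev (rot i l) = b \/
     [/\ m <> [::], cycle (nopinch F) m & ev (rot i l) = b * ev m / b]].
Proof.
move=> lA.
(* Induction on [N], a bound on the number of stable letters in some form of the current
   rotation. *)
suff main N i : i <= size l -> (exists a m,
    [/\ A a, inside A m, size m < N & ev (rot i l) = a * ev m]) -> exists i b m,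
  [/\ i <= size l, A b, inside A m,
     mu b + cost mu m <= K.+1.*2 * (mu 1 + cost mu l) &
     m = [::] /\ ev (rot i l) = b \/
     [/\ m <> [::], cycle (nopinch F) m & ev (rot i l) = b * ev m / b]].
  apply: (main (size l).+1 0) => //; exists 1, l; split=> //.
  by rewrite rot0 mul1g.
elim: N i => [|N IH] i il [a [m [Aa mA mN mE]]] //.
have LA : inside A (rot i l).
  by move: lA; rewrite -{1}(cat_take_drop i l) !inside_cat andbC.
have LE : cost mu (rot i l) = cost mu l.
  by rewrite -[in RHS](cat_take_drop i l) !cost_cat addnC.
have [b [k [Ab kA ks kE [bc _ hd]]]] := reduce muM pinch_cost A1 LA.
rewrite mul1g in kE; rewrite LE in bc.
have := reduced_size Ab Aa kA mA ks (etrans (esym kE) mE).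
case: k kA ks kE bc hd => [|[e c] k] kA ks kE bc hd sz.
  exists i, b, [::]; split=> //; first by move: bc; rewrite /cost big_nil; nlia.
  by left; split=> //; rewrite kE ev_nil mulg1.
have [l1 [c' [l2 [LE2 l1E]]]] := hd _ _ erefl; rewrite mul1g in l1E.
have [/= Ac /= k'A] := (inside_cons _ _).1 kA.
have Ac' : A c'.
  by move: LA; rewrite LE2 inside_cat => /andP[_ /inside_cons[]].
case/lastP: k kA ks kE bc sz k'A hd => [|k [f d]] kA ks kE bc sz k'A hd.
  exists i, b, [:: (e, c * b)]; split=> //; first by apply/inside_cons; split=> //; exact: AM.
    by have := muM Ac Ab; move: bc; rewrite !cost_cons /=; nnia.
  right; split=> //; first by rewrite /= /nopinch /=; case: (e).
  by rewrite kE !ev_seq1 /= !gnorm.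
have [/= Ad kA'] := (inside_rcons _ _).1 k'A.
have Adb : A (d * b) by exact: AM.
have mdb := muM Ad Ab.
(* The element [b] is counted once as conjugator and once at the end of the form: hence the doubled
   constant. *)
have LE3 : ev (rot i l) = b * ev ((e, c) :: rcons k (f, d * b)) / b.
  by rewrite kE !ev_cons !ev_rcons /= !gnorm.
have [red|] := boolP (cycle (nopinch F) ((e, c) :: rcons k (f, d * b))).
  exists i, b, ((e, c) :: rcons k (f, d * b)); split=> //.
  - by apply/inside_cons; split=> //; exact/inside_rcons.
  - move: bc; rewrite -!cats1 !cost_cons !cost_cat !cost_cons /=; nnia.
  - by right.
have kds : path (nopinch F) (e, c) (rcons k (f, d * b)).
  by have := ks; rewrite -rcons_cons (sorted_rcons_nopinch _ _ d (d * b)).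
rewrite /= rcons_path kds last_rcons /= => /nopinchP /= [ef Fdb].
(* The place in the word where the first reduced letter comes from tells how far to rotate: just
   past that letter. *)
have [j jl rotE] : exists2 j, j <= size l & rot j l = l2 ++ l1 ++ [:: (e, c')].
  have l1s : (size l1).+1 <= size (rot i l) by rewrite LE2 size_cat /=; nlia.
  have <- : rot (size l1).+1 (rot i l) = l2 ++ l1 ++ [:: (e, c')].
    by rewrite LE2 -cat_rcons -(size_rcons l1 (e, c')) rot_size_cat -cats1.
  rewrite size_rot in l1s; rewrite rot_add_mod //.
  exists (if (size l1).+1 + i <= size l then (size l1).+1 + i
          else (size l1).+1 + i - size l) => //.
  by case: ifP => // _; nlia.
apply: (IH j jl).
(* In the rotated word the first and the last letter meet in a pinch, whose removal saves two
   letters. *)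
have Ag : A (ltr f * (d * b) / ltr f) by exact/FA/Fconj.
have Acc : A (c'^-1 * c) by apply: AM => //; exact: AV.
have [x [n [Ax nA ns nE]]] := form_mulr (AM Ag Ac') Acc kA'.
exists x, n; split=> //; first by move: sz; rewrite /= size_rcons; nlia.
have l2E : ev l2 = c'^-1 * c * ev k * (ltr f * d).
  apply: (mulgI (b * (ltr e * c'))).
  move: kE; rewrite LE2 ev_cat ev_cons ev_cons ev_rcons l1E /= => kE.
  by rewrite -[LHS]mulgA kE !gnorm.
by rewrite rotE !ev_cat ev_seq1 /= l1E l2E -nE ef ltrN !gnorm.
Qed.
End CyclicReduction.

(** Conjugation by [a] moves the leading base element into the last syllable. *)
Lemma cyclic_form a l : A a -> inside A l -> l <> [::] -> exists m,
  [/\ inside A m, a * ev l = a * ev m / a &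
    forall mu : G -> nat, (forall x y, A x -> A y -> mu (x * y) <= mu x + mu y) ->
      cost mu m <= mu a + cost mu l].
Proof.
case/lastP: l => [|l [e c]] Aa // /inside_rcons [/= Ac lA] _.
exists (rcons l (e, c * a)); split.
- by apply/inside_rcons; split=> //; exact: AM.
- by rewrite !ev_rcons /= !gnorm.
move=> mu muM; have := muM _ _ Ac Aa.
by rewrite -!cats1 !cost_cat !cost_cons /cost !big_nil /=; nlia.
Qed.

Lemma ev_rot i l : i <= size l ->
  ev l = ev (take i l) * ev (rot i l) / ev (take i l).
Proof. by move=> il; rewrite /rot ev_cat -{1}(cat_take_drop i l) ev_cat !gnorm. Qed.

(** Up to conjugacy an element lies in [A] or is cyclically reduced with stable letters; in the
    second case no positive power is trivial. *)
Lemma torsion_free_ext n : 0 < n -> (forall a, A a -> a ^+ n = 1 -> a = 1) ->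
  forall a l, A a -> inside A l -> (a * ev l) ^+ n = 1 -> a * ev l = 1.
Proof.
move=> n0 tf a l Aa lA; have [->|lN] := EM (l = [::]).
  by rewrite ev_nil mulg1; exact: tf.
have expJ (x y : G) : (x * y / x) ^+ n = x * y ^+ n / x.
  by elim: (n) => [|k IH]; [rewrite !expg0 mulg1 mulgV|rewrite !expgS IH !gnorm].
have conj1 (x y : G) : (x * y / x) = 1 -> y = 1.
  by move=> E; rewrite -[y](mulKg x) -[x * y](mulgVK x) E mul1g mulVg.
have [m [mA -> _]] := cyclic_form Aa lA lN.
have [i [b [k [il Ab kA _ alt]]]] := @cyclic_reduce (fun _ => 0) 0
  (fun _ _ _ _ => isT) (fun _ _ _ _ _ _ => isT) _ mA.
rewrite (ev_rot il) !expJ => /conj1 /conj1 E.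
suff -> : ev (rot i m) = 1 by rewrite !gnorm.
case: alt E => [[_ ->]|[kN kc ->]]; first exact: tf.
rewrite expJ => /conj1 E; case: (cyc_red_exp kA kc kN A1 n0).
by rewrite E mul1g.
Qed.
End Britton.
(** * Towers of HNN extensions *)

Section Levels.

(* The letters are ranked by nat; the relation of level i is
   i * xw i * i^-1 = yw i, and it only involves letters of smaller rank. *)
Definition below (i : nat) (w : word nat) : bool := all (fun a => a.1 < i) w.

Lemma below_cat i u v : below i (u ++ v) = below i u && below i v.
Proof. exact: all_cat. Qed.

Lemma below_inv_word i w : below i (inv_word w) = below i w.
Proof. by rewrite /below /inv_word all_rev all_map. Qed.

Lemma below_leq i j w : i <= j -> below i w -> below j w.
Proof. by move=> ij; apply: sub_all => a /leq_trans; apply. Qed.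

(** Edge elements spelled as words: membership in an edge group becomes the triviality of a word,
    see [edge_eval], and can be carried from one group to another. *)
Definition word_subst (c : word nat) (v : word unit) : word nat :=
  flatten [seq (if a.2 then inv_word c else c) | a <- v].

Lemma below_subst i c v : below i c -> below i (word_subst c v).
Proof.
move=> ic; elim: v => //= a v IH; rewrite /word_subst /= below_cat IH andbT.
by case: a.2; rewrite ?below_inv_word.
Qed.

Lemma eval_subst (G : groupType) (s : nat -> G) c v :
  eval s (word_subst c v) = eval (fun _ => eval s c) v.
Proof.
elim: v => [|[a b] v IH]; first by rewrite /word_subst /= !eval_nil.
rewrite /word_subst /= eval_cat IH eval_cons; congr (_ * _).
by case: b; rewrite ?eval_inv_word.
Qed.

Definition flat (i : nat) (w : word nat) (l : seq (bool * word nat)) : word nat :=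
  w ++ flatten [seq (i, p.1) :: p.2 | p <- l].

Definition eval_form (G : groupType) (s : nat -> G) (l : seq (bool * word nat)) :
  seq (bool * G) := [seq (p.1, eval s p.2) | p <- l].

Lemma eval_flat (G : groupType) (s : nat -> G) i w l :
  eval s (flat i w l) = eval s w * ev (s i) (eval_form s l).
Proof.
rewrite /flat eval_cat; congr (_ * _); elim: l => [|[e u] l IH] /=.
  by rewrite eval_nil ev_nil.
by rewrite eval_cons eval_cat IH ev_cons !mulgA.
Qed.

Lemma below_flat i w l : below i w -> all (fun p => below i p.2) l ->
  below i.+1 (flat i w l).
Proof.
move=> wi li; rewrite below_cat (below_leq (leqnSn i)) //=.
elim: l li => //= p l IH /andP[pi li]; rewrite ltnSn /= below_cat IH //.
by rewrite (below_leq (leqnSn i)).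
Qed.

Lemma word_form i w : below i.+1 w -> exists v l,
  [/\ below i v, all (fun p => below i p.2) l & w = flat i v l].
Proof.
elim: w => [|[j b] w IH] /=; first by exists [::], [::].
case/andP=> ji /IH [v [l [vi li ->]]].
case: (ltngtP j i) => [{}ji|ij|->]; last by exists [::], ((b, v) :: l); rewrite /= vi.
  by exists ((j, b) :: v), l; rewrite /= ji.
by move: ji; rewrite ltnS leqNgt ij.
Qed.

Definition gen (G : groupType) (s : nat -> G) (i : nat) (g : G) : Prop :=
  exists2 w, below i w & eval s w = g.

Lemma gen_subgroup (G : groupType) (s : nat -> G) i : subgroup (gen s i).
Proof.
split=> [|_ _ [u ui <-] [v vi <-]|_ [u ui <-]].
- by exists [::]; rewrite ?eval_nil.
- by exists (u ++ v); rewrite ?eval_cat // below_cat ui.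
- by exists (inv_word u); rewrite ?eval_inv_word // below_inv_word.
Qed.

Lemma gen_leq (G : groupType) (s : nat -> G) i j g :
  i <= j -> gen s i g -> gen s j g.
Proof. by move=> ij [w wi wg]; exists w => //; exact: below_leq wi. Qed.

Lemma inside_gen (G : groupType) (s : nat -> G) i l : inside (gen s i) l ->
  exists2 m, all (fun p => below i p.2) m & l = eval_form s m.
Proof.
elim: l => [|[e g] l IH]; first by exists [::].
case/inside_cons=> /= [[w wi <-]] /IH [m mi ->].
by exists ((e, w) :: m); rewrite //= wi.
Qed.

Lemma inside_eval_form (G : groupType) (s : nat -> G) i l :
  all (fun p => below i p.2) l -> inside (gen s i) (eval_form s l).
Proof.
elim: l => // p l IH /andP[pi /IH li].
by apply/(inside_cons _ (p.1, eval s p.2)); split=> //; exists p.2.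
Qed.

Variables xw yw : nat -> word nat.
Definition edge_word (e : bool) i := if e then yw i else xw i.
Hypothesis edge_below : forall e i, below i (edge_word e i).

Definition edge (G : groupType) (s : nat -> G) i e : G -> Prop :=
  cyc (eval s (edge_word e i)).

Definition relation_at (G : groupType) (s : nat -> G) i : Prop :=
  s i * eval s (xw i) / s i = eval s (yw i).

Definition britton_at (G : groupType) (s : nat -> G) i : Prop :=
  britton (gen s i) (edge s i) (s i).

Lemma conj_subst (G : groupType) (s : nat -> G) i e v : relation_at s i ->
  ltr (s i) e * eval s (word_subst (edge_word e i) v) / ltr (s i) e =
  eval s (word_subst (edge_word (~~ e) i) v).
Proof.
move=> rel; rewrite !eval_subst.
have rel_e : ltr (s i) e * eval s (edge_word e i) / ltr (s i) e =
    eval s (edge_word (~~ e) i).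
  by case: e; rewrite //= /ltr /= -rel !gnorm.
elim: v => [|[a b] v IH]; first by rewrite !eval_nil !gnorm.
rewrite !eval_cons -IH /letter /= -rel_e; case: b; by rewrite !gnorm.
Qed.

Lemma stable_ext_level (G : groupType) (s : nat -> G) i :
  relation_at s i -> britton_at s i -> stable_ext (gen s i) (edge s i) (s i).
Proof.
move=> rel brit; split=> //; first exact: gen_subgroup.
- by move=> e; exact: cyc_subgroup.
- move=> e _ [v <-]; exists (word_subst (edge_word e i) v).
    exact: below_subst.
  by rewrite eval_subst.
- move=> e _ [v <-]; exists v.
  by rewrite -!eval_subst conj_subst.
Qed.

Lemma edge_eval (G : groupType) (s : nat -> G) i e w :
  edge s i e (eval s w) <->
  exists v, eval s (w ++ inv_word (word_subst (edge_word e i) v)) = 1.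
Proof.
split=> -[v vE]; exists v; move: vE; rewrite eval_cat eval_inv_word eval_subst.
  by move=> ->; rewrite mulgV.
by move/divg1_eq.
Qed.

(** Pinches are detected by words in the letters up to [i], so the condition only depends on which
    of these words are trivial. *)
Lemma britton_transport (G H : groupType) (s : nat -> G) (r : nat -> H) i :
  (forall w, below i.+1 w -> eval s w = 1 <-> eval r w = 1) ->
  britton_at s i -> britton_at r i.
Proof.
move=> sr brit _ l [w wi <-] /inside_gen [m mi ->] ms mN.
rewrite -eval_flat => /(sr _ (below_flat wi mi)).2; rewrite eval_flat.
apply: brit; [by exists w|exact: inside_eval_form| |by case: (m) mN].
have mP : all [pred p | below i p.2] m by exact: mi.
move: ms; rewrite !sorted_map; apply: (sub_in_sorted _ mP) => p q.
rewrite inE => pi _; rewrite /nopinch /=; apply: contra => /andP[-> /asboolP /=].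
move/edge_eval => [v vE]; apply/asboolP/edge_eval; exists v; apply/sr => //.
rewrite below_cat below_inv_word !(below_leq (leqnSn i)) //.
exact: below_subst.
Qed.

Lemma not_sorted_split (T : Type) (e : rel T) (l : seq T) : ~~ sorted e l ->
  exists l1 p q l2, l = l1 ++ p :: q :: l2 /\ ~~ e p q.
Proof.
case: l => // p l; elim: l p => //= q l IH p; rewrite negb_and.
case/orP=> [npq|/IH [l1 [p' [q' [l2 [-> n]]]]]]; first by exists [::], p, q, l.
by exists (p :: l1), p', q', l2.
Qed.

(* A word that is trivial in K reduces to the empty word by Britton's lemma, so
   it is trivial in every group satisfying the relations. *)
Lemma britton_universal (K G : groupType) (s : nat -> K) (r : nat -> G) i :
  (forall j, j < i -> relation_at s j /\ britton_at s j) ->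
  (forall j, j < i -> relation_at r j) ->
  forall w, below i w -> eval s w = 1 -> eval r w = 1.
Proof.
elim: i => [|i IH] sK rG.
  by case=> // _ _; rewrite eval_nil.
have {}IH : forall w, below i w -> eval s w = 1 -> eval r w = 1.
  by apply: IH => j ji; [apply: sK|apply: rG]; exact: ltnW.
have [reli briti] := sK i (ltnSn i); have relG := rG i (ltnSn i).
(* Inner induction on the number of occurrences of the letter [i]; the outer one handles words of
   the level below, in particular the word witnessing a pinch. *)
move=> w; have [n] := ubnP (count (fun a => a.1 == i) w).
elim: n w => // n IHn w wn /word_form [v [l [vi li wE]]] w_1.
case: l li wE => [|q l] li wE.
  by apply: IH => //; move: wE; rewrite /flat cats0 => ->.
have lN : eval_form s (q :: l) <> [::] by [].
set m := q :: l in li wE lN.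
have /negP nsorted : ~ sorted (nopinch (edge s i)) (eval_form s m).
  move=> ms; case: (briti (eval s v) _ _ (inside_eval_form s li) ms lN).
    by exists v.
  by rewrite -eval_flat -wE w_1.
rewrite sorted_map in nsorted.
have [l1 [[e w1] [[f w2] [l2 [mE np]]]]] := not_sorted_split nsorted.
have [/= fE /edge_eval [u uE]] := @nopinchP _ _ (e, eval s w1) (f, eval s w2) np.
set c1 := word_subst (edge_word e i) u in uE.
set c2 := word_subst (edge_word (~~ e) i) u.
move: li; rewrite mE all_cat /= => /and4P[l1i w1i w2i l2i].
have c1i : below i c1 by exact: below_subst.
have c2i : below i c2 by exact: below_subst.
have wE2 : w = flat i v l1 ++ (i, e) :: w1 ++ (i, f) :: flat i w2 l2.
  by rewrite wE mE /flat map_cat flatten_cat /= -!catA.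
set w' := flat i v l1 ++ c2 ++ flat i w2 l2.
have red (H : groupType) (h : nat -> H) : relation_at h i ->
    eval h (w1 ++ inv_word c1) = 1 -> eval h w = eval h w'.
  rewrite eval_cat eval_inv_word => relh /divg1_eq E.
  rewrite wE2 /w' !(eval_cat, eval_cons); congr (_ * _).
  rewrite E fE /c2 -(conj_subst e u relh) !mulgA; congr (_ * _ * _).
  by rewrite -[letter h (_, ~~ e)]/(ltr (h i) (~~ e)) ltrN.
have w1c1 : below i (w1 ++ inv_word c1) by rewrite below_cat below_inv_word w1i.
rewrite (red _ _ relG (IH _ w1c1 uE)); apply: IHn.
- have c20 : count (fun a => a.1 == i) c2 = 0.
    apply/eqP; rewrite -leqn0 leqNgt -has_count -all_predC.
    by apply: sub_all c2i => a /=; case: ltngtP.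
  move: wn; rewrite wE2 /w' /flat !count_cat /= !count_cat /= !count_cat eqxx c20 /=; nlia.
- have vB := below_flat vi l1i; have wB := below_flat w2i l2i.
  by rewrite /w' below_cat vB below_cat wB (below_leq (leqnSn i) c2i).
- by rewrite -(red _ _ reli uE).
Qed.

(** * Identification of the presented group with the top of the tower *)

Variables (G : groupType) (r : nat -> G) (N : nat).
Hypothesis r_rel : forall i, i < N -> relation_at r i.
Hypothesis r_edge : forall i, i < N ->
  (xw i = [::] /\ yw i = [::]) \/ (eval r (xw i) <> 1 /\ eval r (yw i) <> 1).

(** Torsion-freeness is carried along because it gives both edge generators infinite order in [K],
    so that the next HNN extension exists. *)
Lemma tower i : i <= N -> exists (K : groupType) (s : nat -> K),
  (forall j, j < i -> relation_at s j /\ britton_at s j) /\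
  (forall g n, gen s i g -> 0 < n -> g ^+ n = 1 -> g = 1).
Proof.
elim: i => [|i IH] iN.
  exists G, (fun _ => 1); split=> // _ n [[|//] _ <-] _ _.
  by rewrite eval_nil.
have [K [s [sK tf]]] := IH (ltnW iN).
have univ := britton_universal sK (fun j ji => r_rel (ltn_trans ji iN)).
have orders (v : word unit) : eval (fun _ => eval s (xw i)) v = 1 <->
                eval (fun _ => eval s (yw i)) v = 1.
  case: (r_edge iN) => [[-> ->]|[x1 y1]]; first by rewrite eval_nil.
  have [b [n [_ vE]]] := unit_word_exp v; rewrite !vE.
  case: n vE => [|n] _; first by rewrite !expg0.
  (* A trivial power in [K] makes the edge generator trivial in [K], hence in [G], since [K] maps
     onto the corresponding subgroup of [G] by [univ]. *)
  have nt e : eval r (edge_word e i) <> 1 -> eval s (edge_word e i) ^+ n.+1 <> 1.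
    move=> c1 cn; apply/c1/univ; first exact: edge_below.
    by apply: (tf _ n.+1) => //; exists (edge_word e i).
  have sgn1 (g : K) : sgn b g = 1 -> g = 1.
    by case: (b) => //= /(congr1 inv); rewrite invgK invg1.
  rewrite !sgn_exp; split=> /sgn1 E; first by case: (nt false x1 E).
  by case: (nt true y1 E).
have [B [f [t [fM fI ft brit]]]] := hnn_extension orders.
have f1 : f 1 = 1 by apply: (mulIg (f 1)); rewrite -fM !mul1g.
have fV a : f a^-1 = (f a)^-1.
  by apply: (mulIg (f a)); rewrite -fM !mulVg.
pose r' j := if j < i then f (s j) else t.
have r'i : r' i = t by rewrite /r' ltnn.
have r'E w : below i w -> eval r' w = f (eval s w).
  elim: w => [|[j b] w IHw] /=; first by rewrite !eval_nil f1.
  case/andP=> ji /IHw E; rewrite !eval_cons fM E; congr (_ * _).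
  by rewrite /letter /= /r' ji; case: b.
have r'1 w : below i w -> eval s w = 1 <-> eval r' w = 1.
  move=> wi; rewrite r'E //; split=> [->|] //.
  by rewrite -f1 => /fI.
have edge_i e : below i (edge_word e i) by exact: edge_below.
have rel_i : relation_at r' i.
  by rewrite /relation_at !r'E ?r'i //; [exact: (edge_i true)|exact: (edge_i false)].
have edgeE e : edge r' i e = cyc (f (if e then eval s (yw i) else eval s (xw i))).
  by rewrite /edge r'E //; case: e.
have gen_f g : gen r' i g -> exists a, g = f a.
  by case=> w wi <-; exists (eval s w); exact: r'E.
have brit_i : britton_at r' i.
  rewrite /britton_at r'i => a l /gen_f Aa lA ls; apply: brit => //.
    by apply: sub_all lA => p /asboolP /gen_f ?; exact/asboolP.
  by apply: sub_sorted ls => p q; rewrite /nopinch edgeE.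
exists B, r'; split=> [j|g n].
  rewrite ltnS leq_eqVlt => /orP[/eqP -> //|ji]; have [rel_j brit_j] := sK j ji.
  split; last first.
    by apply: britton_transport brit_j => w wj; apply/r'1/(below_leq ji).
  have lej e : below i (edge_word e j) := below_leq (ltnW ji) (edge_below e j).
  rewrite /relation_at (r'E _ (lej false)) (r'E _ (lej true)) /r' ji.
  by rewrite -fV -!fM rel_j.
case=> w /word_form [v [l [vi li ->]]] <- n0; rewrite eval_flat.
apply: (torsion_free_ext (stable_ext_level rel_i brit_i) n0).
- move=> _ [u ui <-]; rewrite r'E // => E.
  suff -> : eval s u = 1 by [].
  apply: (tf _ n) => //; first by exists u.
  by apply: fI; rewrite f1 -E; elim: (n) => // k IHk; rewrite ?expgS ?fM ?IHk.
- by exists v.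
- exact: inside_eval_form.
Qed.

Hypothesis r_universal : forall w, below N w -> eval r w = 1 ->
  forall (K : groupType) (s : nat -> K),
    (forall i, i < N -> relation_at s i) -> eval s w = 1.

(** The top of the tower and [G] have the same trivial words: [britton_universal] gives one
    inclusion, the universal property of [G] the other. *)
Lemma britton_presented i : i < N -> britton_at r i.
Proof.
move=> iN; have [K [s [sK _]]] := tower (leqnn N).
apply: britton_transport (sK i iN).2 => w wi.
have wN := below_leq iN wi; split=> E.
  exact: (britton_universal sK).
by apply: r_universal => // j /sK [].
Qed.

Lemma torsion_free_presented g n : gen r N g -> 0 < n -> g ^+ n = 1 -> g = 1.
Proof.
have [K [s [sK tf]]] := tower (leqnn N).
have kerE w : below N w -> eval s w = 1 <-> eval r w = 1.
  move=> wN; split=> E; first exact: (britton_universal sK).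
  by apply: r_universal => // j /sK [].
case=> w wN <- n0.
have wX (H : groupType) (h : nat -> H) : eval h (flatten (nseq n w)) = eval h w ^+ n.
  by elim: (n) => [|k IH] /=; rewrite ?eval_nil ?eval_cat ?IH ?expgS.
have wnN : below N (flatten (nseq n w)).
  by elim: (n) => //= k IH; rewrite below_cat wN.
rewrite -wX => /(kerE _ wnN).2; rewrite wX => E; apply/kerE => //.
by apply: (tf _ n) => //; exists w.
Qed.

End Levels.
(** * Length and distortion of cyclic subgroups *)

Section Growth.
Local Open Scope nat_scope.

(** Bernoulli's inequality yields an exponent [j] where the ratio of the two powers is at least
    [4 * c]; doubling [j] also absorbs the linear term. *)
Lemma exp_growth m c : 0 < m -> exists k, c * (m ^ k + k) < m.+1 ^ k.
Proof.
move=> m0; case: (posnP c) => [->|c0]; first by exists 0.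
have bern a k : a ^ k * (a + k) <= a * a.+1 ^ k.
  elim: k => [|k IH]; first by rewrite !expn0 addn0 mul1n muln1.
  have -> : a ^ k.+1 = a * a ^ k by rewrite expnS.
  have -> : a.+1 ^ k.+1 = a.+1 * a.+1 ^ k by rewrite expnS.
  by nnia.
have pow2 k : k.*2 <= 2 ^ k.
  case: k => // k; have -> : 2 ^ k.+1 = 2 * 2 ^ k by rewrite expnS.
  by have := ltn_expl k (isT : 1 < 2); nlia.
pose j := 4 * c * m; exists j.*2.
have mj : 4 * c * m ^ j <= m.+1 ^ j.
  by rewrite -(leq_pmul2l m0); apply: leq_trans (bern m j); rewrite /j; nnia.
have mm : m ^ j <= m.+1 ^ j by rewrite leq_exp2r // /j; nnia.
have m1 : 0 < m ^ j by rewrite expn_gt0 m0.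
have m2 : j.*2 <= m.+1 ^ j.
  by apply: leq_trans (pow2 j) _; rewrite leq_exp2r // /j; nnia.
rewrite -addnn !expnD addnn; move: (m ^ j) (m.+1 ^ j) mj mm m1 m2 => a b.
move: (j.*2) => d mj mm m1 m2.
have ab : a * a <= a * b by rewrite leq_mul2l mm orbT.
have db : d <= a * b by apply: leq_trans m2 _; rewrite leq_pmull.
have : 4 * c * a * b <= b * b by rewrite leq_mul2r mj orbT.
have : 0 < c * (a * b) by rewrite !muln_gt0 c0 m1 (leq_trans m1 mm).
have -> : 4 * c * a * b = 4 * (c * (a * b)) by rewrite !mulnA.
have : c * (a * a) <= c * (a * b) by rewrite leq_mul2l ab orbT.
have : c * d <= c * (a * b) by rewrite leq_mul2l db orbT.
by rewrite mulnDr; nlia.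
Qed.

(** Iteration bounds [f (n ^ k)] by [f (m ^ k) + k * X]. As [f] grows linearly from both sides,
    [n ^ k] is at most a constant times [m ^ k + k], which fails for [m < n] and a suitable [k]. *)
Lemma linear_rigid (f : nat -> nat) K X m n : (forall j, j <= K * f j) ->
  (forall j, f (n * j) <= f (m * j) + X) -> f (m * 0) = 0 ->
  (forall j, f j <= j * f 1) -> n <= m.
Proof.
move=> fK fX f0 fL; rewrite leqNgt; apply/negP => mn.
case: (posnP m) => [m0|m0].
  have [j jE] : exists j, j = (K * X).+1 by eexists.
  have := fX j; have := fK (n * j).
  rewrite muln0 in f0; rewrite m0 mul0n f0 add0n => h1 h2.
  have : K * f (n * j) <= K * X by rewrite leq_mul2l h2 orbT.
  have : j <= n * j by rewrite leq_pmull //; nlia.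
  nlia.
have iter k j : f (n ^ k * j) <= f (m ^ k * j) + k * X.
  elim: k j => [|k IH] j; first by rewrite !expn0 mul0n addn0.
  have -> : n ^ k.+1 * j = n * (n ^ k * j) by rewrite expnS mulnA.
  have -> : m ^ k.+1 * j = m ^ k * (m * j) by rewrite expnSr mulnA.
  apply: leq_trans (fX _) _; have := IH (m * j); rewrite mulnCA mulSn; nlia.
have [k] := exp_growth (K * (f 1 + X)) m0; rewrite ltnNge => /negP[].
have mnk : m.+1 ^ k <= n ^ k by case: (k) => // j; rewrite leq_exp2r.
apply: leq_trans mnk _; apply: leq_trans (fK _) _.
rewrite -mulnA leq_mul2l; apply/orP; right.
have := iter k 1; have := fL (m ^ k); rewrite !muln1; move: (m ^ k) => a; nnia.
Qed.

End Growth.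

Record is_length (G : groupType) (len : G -> nat) : Prop := IsLength {
  len1 : len 1 = 0;
  len_eq0 : forall g, len g = 0 -> g = 1;
  lenM : forall g h, len (g * h) <= len g + len h;
  lenV : forall g, len g^-1 = len g }.

Section Length.
Variables (G : groupType) (len : G -> nat).
Hypothesis len_len : is_length len.
Implicit Types (g h x y : G).

(** The cyclic subgroup of [g] is infinite and undistorted; this is the form in which the distortion
    hypothesis is used. *)
Definition lin g : Prop := exists K, forall n, n <= K * len (g ^+ n).

Lemma len_exp g n : len (g ^+ n) <= n * len g.
Proof.
elim: n => [|n IH]; first by rewrite expg0 (len1 len_len).
by rewrite expgS mulSn (leq_trans (lenM len_len _ _)) ?leq_add2l.
Qed.

Lemma len_sgn b g : len (sgn b g) = len g.
Proof. by case: b; rewrite //= (lenV len_len). Qed.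

Lemma len_sgn_exp b g n : len (sgn b g ^+ n) = len (g ^+ n).
Proof. by rewrite sgn_exp len_sgn. Qed.

Lemma len_conj x g : len (x * g / x) <= len g + (len x).*2.
Proof.
have := lenM len_len (x * g) x^-1; have := lenM len_len x g.
by rewrite (lenV len_len); nlia.
Qed.

Lemma len_mul3 x y z : len (x * y * z) <= len x + len y + len z.
Proof. by have := lenM len_len (x * y) z; have := lenM len_len x y; nlia. Qed.

Lemma len_exp_diff g a b : len (g ^- a * g ^+ b) <= ((a - b) + (b - a)) * len g.
Proof.
case: (leqP a b) => ab.
  by rewrite -{1}(subnKC ab) expgnDr mulKg (eqP ab) add0n len_exp.
rewrite -(lenV len_len) invgM invgK -{1}(subnKC (ltnW ab)) expgnDr mulKg.
by rewrite (eqP (ltnW ab)) addn0 len_exp.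
Qed.

Lemma conjg_expE x g n : (x * g / x) ^+ n = x * g ^+ n / x.
Proof.
elim: n => [|n IH]; first by rewrite !expg0 mulg1 mulgV.
by rewrite !expgS IH !gnorm.
Qed.

(* Passing to powers absorbs the length of the conjugator, so that the constant
   K is preserved. *)
Lemma lin_conj g K : (forall n, n <= K * len (g ^+ n)) ->
  forall x n, n <= K * len (x * g ^+ n / x).
Proof.
move=> gK x n; rewrite leqNgt; apply/negP => lt.
set y := x * g ^+ n / x in lt.
have [N NE] : exists N, N = (K * (len x).*2).+1 by eexists.
have yN : len (g ^+ (n * N)) <= N * len y + (len x).*2.
  rewrite expgnA; have -> : g ^+ n ^+ N = x^-1 * y ^+ N / x^-1.
    by rewrite -conjg_expE /y; congr (_ ^+ N); rewrite !gnorm.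
  by apply: leq_trans (len_conj _ _) _; rewrite (lenV len_len) leq_add2r len_exp.
have := gK (n * N)%N; move: (len (g ^+ (n * N)%N)) yN => a ale na.
have : K * a <= K * (N * len y + (len x).*2) by rewrite leq_mul2l ale orbT.
have : (K * len y).+1 * N <= n * N by rewrite leq_mul2r lt orbT.
by rewrite mulSn mulnDr [(N * _)%N]mulnC mulnA; nlia.
Qed.

Lemma lin_sgn b g : lin g -> lin (sgn b g).
Proof. by move=> [K gK]; exists K => n; rewrite len_sgn_exp. Qed.

Lemma lin_conjugate x g : lin g -> lin (x * g / x).
Proof. by move=> [K gK]; exists K => n; rewrite conjg_expE; exact: lin_conj. Qed.

Lemma lin_exp_eq1 g n : lin g -> g ^+ n = 1 -> n = 0.
Proof.
by move=> [K /(_ n)] + gn; rewrite gn (len1 len_len) muln0 leqn0 => /eqP.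
Qed.

(** Conjugation by [x] changes lengths by at most twice that of [x], so [linear_rigid] excludes
    Baumslag-Solitar relations with different exponents. *)
Lemma exp_sgn_conj_inj g x b b' m n : lin g ->
  x * sgn b g ^+ m / x = sgn b' g ^+ n -> m = n.
Proof.
move=> [K gK].
suff le y c c' k l : y * sgn c g ^+ k / y = sgn c' g ^+ l -> l <= k.
  move=> E; apply/eqP; rewrite eqn_leq (le _ _ _ _ _ E) andbT.
  by apply: (le x^-1 b' b); rewrite -E !gnorm.
move=> E; apply: (@linear_rigid (fun j => len (g ^+ j)) K (len y).*2) => //=.
- move=> j; rewrite -(len_sgn_exp c') expgnA -E conjg_expE -expgnA.
  by rewrite -(len_sgn_exp c g (k * j)%N) len_conj.
- by rewrite muln0 expg0 (len1 len_len).
- by move=> j; rewrite expg1 len_exp.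
Qed.

Lemma exp_conj_inj g x m n : lin g -> x * g ^+ m / x = g ^+ n -> m = n.
Proof. exact: (@exp_sgn_conj_inj g x false false). Qed.

End Length.
(** * Long rectangles with powers on two opposite sides *)

Lemma conj_flip (G : groupType) (x h h' z : G) (m n : nat) :
  x ^+ m * h = h' * z ^+ n -> h'^-1 * x ^+ m = z ^+ n * h^-1.
Proof. by move=> E; apply: (mulIg h); rewrite -mulgA E !gnorm. Qed.

Section Rectangle.
Variables (G : groupType) (len : G -> nat).
Hypothesis len_len : is_length len.
Implicit Types (B : G -> Prop) (x z g h : G).

(* x ^+ m, h, z ^+ m' and h' are the sides of a rectangle; if it is long and thin,
   then h conjugates a fixed power of x into a power of z. *)
Definition rectangle_cst B x z (C P : nat) : Prop :=
  forall h h' m m', B h -> B h' -> x ^+ m * h = h' * z ^+ m' ->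
    m <= C * (len h + len h') + C \/ exists q, x ^+ P * h = h * z ^+ q.

Definition rectangle B x z : Prop :=
  exists C P, 0 < P /\ rectangle_cst B x z C P.

Lemma rectangle_mono B x z C P D Q : C <= D -> P %| Q ->
  rectangle_cst B x z C P -> rectangle_cst B x z D Q.
Proof.
move=> CD /dvdnP [k ->] R h h' m m' Bh Bh' /(R _ _ _ _ Bh Bh') [mC|[q E]].
  left; apply: leq_trans mC _; apply: leq_add => //.
  by rewrite leq_mul2r CD orbT.
right; exists (q * k)%N; rewrite mulnC !expgnA.
elim: k => [|k IH]; first by rewrite !expg0 mul1g mulg1.
by rewrite !expgS -mulgA IH !mulgA E.
Qed.

Lemma rectangle_conj B x z g g' : subgroup B -> B g -> B g' ->
  rectangle B x z -> rectangle B (g * x / g) (g' * z / g').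
Proof.
move=> [_ BM BV] Bg Bg' [C [P [P0 R]]].
pose L := (len g + len g')%N.
exists (C * L.*2 + C)%N, P; split=> // h h' m m' Bh Bh'.
rewrite !conjg_expE => E.
have [|||mC|[q Eq]] := R (g^-1 * h * g') (g^-1 * h' * g') m m'.
- by apply: (BM) => //; apply: (BM) => //; exact: BV.
- by apply: (BM) => //; apply: (BM) => //; exact: BV.
- transitivity (g^-1 * (g * x ^+ m / g * h) * g'); first by rewrite !gnorm.
  by rewrite E !gnorm.
- left; apply: leq_trans mC _.
  have := len_mul3 len_len g^-1 h g'; have := len_mul3 len_len g^-1 h' g'.
  rewrite (lenV len_len) => le' le.
  have : len (g^-1 * h * g') + len (g^-1 * h' * g') <= len h + len h' + L.*2.
    by apply: leq_trans (leq_add le le') _; rewrite /L; nlia.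
  by move/(leq_mul (leqnn C)); rewrite [(C * (_ + L.*2))%N]mulnDr mulnDl; nlia.
right; exists q; rewrite !conjg_expE.
transitivity (g * (x ^+ P * (g^-1 * h * g')) / g'); first by rewrite !gnorm.
by rewrite Eq !gnorm.
Qed.

(** * Commensurability in a finite family, and matching exponents *)

Section Weights.
Variables (T : finType) (f : T -> G).
Hypothesis f_lin : forall i, lin len (f i).

Definition commensurable (x z : G) : Prop :=
  exists g p q, 0 < p /\ x ^+ p * g = g * z ^+ q.

Lemma commensurable_pos (x g z : G) p q : lin len x -> 0 < p ->
  x ^+ p * g = g * z ^+ q -> 0 < q.
Proof.
move=> lx p0 E; rewrite lt0n; apply/eqP => q0; move: E p0.
by rewrite q0 expg0 mulg1 -[RHS]mul1g => /mulIg /(lin_exp_eq1 len_len lx) ->.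
Qed.

Lemma exp_comm (x z g : G) p q k :
  x ^+ p * g = g * z ^+ q -> x ^+ (p * k) * g = g * z ^+ (q * k).
Proof.
move=> E; rewrite !expgnA; elim: k => [|k IH]; first by rewrite !expg0 mul1g mulg1.
by rewrite !expgS -mulgA IH !mulgA E.
Qed.

Lemma commensurable_sym x z : lin len x -> commensurable x z -> commensurable z x.
Proof.
move=> lx [g [p [q [p0 E]]]]; exists g^-1, q, p; split.
  exact: (commensurable_pos lx p0 E).
by apply: (mulgI g); apply: (mulIg g); rewrite !mulgA !gnorm -E.
Qed.

Lemma commensurable_trans x y z : lin len y ->
  commensurable x y -> commensurable y z -> commensurable x z.
Proof.
move=> ly [g [p [q [p0 E]]]] [g' [p' [q' [p'0 E']]]].
exists (g * g'), (p * p')%N, (q' * q)%N; split; first by rewrite muln_gt0 p0.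
by rewrite mulgA (exp_comm p' E) -mulgA [(q * p')%N]mulnC (exp_comm q E') mulgA.
Qed.

(** In each class a representative is fixed, and some power of [f i] is conjugate to its power
    [qd i]. Multiplying by all the other [qd k] raises every member to a conjugate of the same power
    [Q] of the representative. *)
Lemma commensurable_weights : exists W : T -> nat, (forall i, 0 < W i) /\
  forall i j, commensurable (f i) (f j) ->
    exists g, f i ^+ W i * g = g * f j ^+ W j.
Proof.
pose cm i j := `[< commensurable (f i) (f j) >].
have cm_refl i : cm i i by apply/asboolP; exists 1, 1%N, 1%N; rewrite mulg1 mul1g.
pose rho i := odflt i [pick k | cm i k].
have rhoP i : commensurable (f i) (f (rho i)).
  by rewrite /rho; case: pickP => [k /asboolP //|/(_ i)]; rewrite cm_refl.
have rhoE i j : commensurable (f i) (f j) -> rho i = rho j.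
  move=> cij; rewrite /rho (@eq_pick _ (cm i) (cm j)); last first.
    move=> k; apply: asbool_equiv_eq; split=> ck.
      exact: (commensurable_trans (f_lin i) (commensurable_sym (f_lin i) cij) ck).
    exact: (commensurable_trans (f_lin j) cij ck).
  by case: pickP => // /(_ j); rewrite cm_refl.
pose gd i := projT1 (cid (rhoP i)).
pose pd i := projT1 (cid (projT2 (cid (rhoP i)))).
pose qd i := projT1 (cid (projT2 (cid (projT2 (cid (rhoP i)))))).
have dP i : 0 < pd i /\ f i ^+ pd i * gd i = gd i * f (rho i) ^+ qd i.
  exact: projT2 (cid (projT2 (cid (projT2 (cid (rhoP i)))))).
have q0 i : 0 < qd i by have [p0 E] := dP i; exact: (commensurable_pos (f_lin i) p0 E).
pose Q := (\prod_i qd i)%N.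
pose W i := (pd i * \prod_(k | k != i) qd k)%N.
have WE i : f i ^+ W i * gd i = gd i * f (rho i) ^+ Q.
  have -> : Q = (qd i * \prod_(k | k != i) qd k)%N by rewrite /Q (bigD1 i).
  exact: exp_comm (dP i).2.
exists W; split=> [i|i j cij].
  by rewrite muln_gt0 (dP i).1 prodn_gt0.
exists (gd i / gd j); rewrite mulgA WE (rhoE _ _ cij).
have -> : f (rho j) ^+ Q = (gd j)^-1 * (f j ^+ W j * gd j) by rewrite WE mulKg.
by rewrite !gnorm.
Qed.

(** One constant for all pairs, and exponents [N i] fixed in advance: if any positive power of [f i]
    is conjugated into powers of [f j], rigidity forces the exponent [N i] to go with [N j]. *)
Lemma rectangle_weights (A : G -> Prop) : (forall i j, rectangle A (f i) (f j)) ->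
  exists C (N : T -> nat), [/\ forall i, 0 < N i,
    forall i j h h' m m', A h -> A h' -> f i ^+ m * h = h' * f j ^+ m' ->
      m <= C * (len h + len h') + C \/ f i ^+ N i * h = h * f j ^+ N j &
    forall i j g p q, 0 < p -> f i ^+ p * g = g * f j ^+ q ->
      exists g', f i ^+ N i * g' = g' * f j ^+ N j].
Proof.
move=> R; have [W [W0 WE]] := commensurable_weights.
pose CC (ij : T * T) := projT1 (cid (R ij.1 ij.2)).
pose PP (ij : T * T) := projT1 (cid (projT2 (cid (R ij.1 ij.2)))).
have PC ij : 0 < PP ij /\ rectangle_cst A (f ij.1) (f ij.2) (CC ij) (PP ij).
  exact: projT2 (cid (projT2 (cid (R ij.1 ij.2)))).
pose C := \max_ij CC ij; pose P := (\prod_ij PP ij)%N.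
have P0 : 0 < P by apply: prodn_gt0 => ij; case: (PC ij).
have RP i j : rectangle_cst A (f i) (f j) C P.
  apply: rectangle_mono (PC (i, j)).2; first exact: leq_bigmax.
  by rewrite /P (bigD1 (i, j)) //= dvdn_mulr.
have NE i j g p q : 0 < p -> f i ^+ p * g = g * f j ^+ q ->
    exists g', f i ^+ (P * W i) * g' = g' * f j ^+ (P * W j).
  move=> p0 E; have [|g' E'] := WE i j; first by exists g, p, q.
  by exists g'; rewrite ![(P * _)%N]mulnC; exact: exp_comm.
exists C, (fun i => P * W i)%N; split=> //.
  by move=> i; rewrite muln_gt0 P0 W0.
move=> i j h h' m m' Ah Ah' /(RP _ _ _ _ _ _ Ah Ah') [|[q E]]; [by left|right].
have [g' E'] := NE _ _ _ _ _ P0 E.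
have E2 := exp_comm (W i) E; rewrite E2; congr (_ * _ ^+ _).
apply: (exp_conj_inj len_len (f_lin j) (x := g'^-1 * h)).
rewrite invgM invgK -[X in X * _]mulgA -E2 !mulgA.
rewrite -[g'^-1 * _ * h * h^-1]mulgA mulgV mulg1 -mulgA E' mulKg //.
Qed.

End Weights.
End Rectangle.

(** * Rectangles in one step of the tower *)

Section Level.
Variables (G : groupType) (len : G -> nat).
Hypothesis len_len : is_length len.
Variables (A B : G -> Prop) (t : G) (c : bool -> G).
Hypothesis AFt : stable_ext A (fun e => cyc (c e)) t.
Hypothesis Bsub : subgroup B.
Hypothesis c_conj : forall e, ltr t e * c e / ltr t e = c (~~ e).
Hypothesis c_lin : (forall e, c e = 1) \/ (forall e, lin len (c e)).
Hypothesis len_t : len t <= 1.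
Local Notation ev := (ev t).
Local Notation ltr := (ltr t).
Local Notation F := (fun e => cyc (c e)).

Let A1 : A 1. Proof. by case: (stable_subgroup AFt). Qed.
Let AM a b : A a -> A b -> A (a * b).
Proof. by case: (stable_subgroup AFt) => _ + _; apply. Qed.
Let AV a : A a -> A a^-1.
Proof. by case: (stable_subgroup AFt) => _ _; apply. Qed.

Lemma len_ltr e : len (ltr e) <= 1.
Proof. by rewrite len_sgn. Qed.

Lemma c_exp_conj e b n :
  ltr e * sgn b (c e) ^+ n / ltr e = sgn b (c (~~ e)) ^+ n.
Proof.
rewrite -conjg_expE -c_conj; congr (_ ^+ _).
by case: b; rewrite //= !gnorm.
Qed.

Lemma ltr_c_exp e b n :
  sgn b (c (~~ e)) ^+ n * ltr e = ltr e * sgn b (c e) ^+ n.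
Proof. by rewrite -c_exp_conj !gnorm. Qed.

Lemma A_c e b n : A (sgn b (c e) ^+ n).
Proof. by apply: (stable_edge_sub AFt (e := e)); apply/cycP; exists b, n. Qed.

Lemma c_lin_uniform : (forall e, lin len (c e)) ->
  exists K, forall e n, n <= K * len (c e ^+ n).
Proof.
move=> cl; have [Kt tP] := cl true; have [Kf fP] := cl false.
exists (Kt + Kf) => -[] n; rewrite mulnDl; first by rewrite (leq_trans (tP n)) ?leq_addr.
by rewrite (leq_trans (fP n)) ?leq_addl.
Qed.

Section Pinch.
Variable mu : G -> nat.
Hypothesis len_mu : forall a, A a -> len a <= mu a.

Lemma len_ev l : inside A l -> len (ev l) <= cost mu l.
Proof.
elim: l => [|[e a] l IH]; first by rewrite ev_nil (len1 len_len).
case/inside_cons=> /= Aa /IH le; rewrite ev_cons cost_cons /=.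
have := len_mul3 len_len (ltr e) a (ev l); have := len_ltr e.
by have := len_mu Aa; nlia.
Qed.

Lemma pinch_bound K0 : (forall e b n, mu (sgn b (c e) ^+ n) <= n * K0) ->
  exists K, forall e a l, A a -> inside A l -> cyc (c e) (a * ev l) ->
    mu (ltr e * (a * ev l) / ltr e) <= K * (mu a + cost mu l).
Proof.
move=> mu_c; case: c_lin => [c1|cl].
  exists 0 => e a l Aa lA /cycP [b [n ->]]; rewrite c_exp_conj c1 -(c1 e).
  by apply: leq_trans (_ : 0 <= _) => //; rewrite c1; have := mu_c e b 0;
     rewrite expg0 mul0n; case: (b); rewrite /= ?invg1 expg1n.
have [K KP] := c_lin_uniform cl.
exists (K * K0)%N => e a l Aa lA /cycP [b [n E]].
rewrite E c_exp_conj; apply: leq_trans (mu_c _ _ _) _.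
rewrite [(K * K0)%N]mulnC -mulnA [X in _ <= X]mulnC leq_mul2r; apply/orP; right.
apply: leq_trans (KP e n) _; rewrite leq_mul2l; apply/orP; right.
rewrite -(len_sgn_exp len_len b) -E; apply: leq_trans (lenM len_len _ _) _.
by apply: leq_add; [exact: len_mu|exact: len_ev].
Qed.

End Pinch.

Variable C0 : nat.
Hypothesis form_B : forall a l, A a -> inside A l -> B (a * ev l).
Hypothesis B_form : forall g, B g -> exists a l,
  [/\ A a, inside A l, g = a * ev l & len a + cost len l <= C0 * len g].

Let BM a b : B a -> B b -> B (a * b).
Proof. by case: Bsub => _ + _; apply. Qed.
Let BV a : B a -> B a^-1.
Proof. by case: Bsub => _ _; apply. Qed.

Let lenMA a b : A a -> A b -> len (a * b) <= len a + len b.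
Proof. by move=> _ _; exact: lenM. Qed.

Lemma A_B a : A a -> B a.
Proof. by move=> Aa; have := form_B Aa (isT : inside A [::]); rewrite ev_nil mulg1. Qed.

Lemma size_cost (mu : G -> nat) l : size l <= cost mu l.
Proof. by elim: l => // p l IH; rewrite cost_cons /=; nlia. Qed.

Lemma pinch_len : exists K, forall e a l, A a -> inside A l ->
  cyc (c e) (a * ev l) -> len (ltr e * (a * ev l) / ltr e) <= K * (len a + cost len l).
Proof.
apply: (pinch_bound (fun _ _ => leqnn _) (K0 := len (c true) + len (c false))).
move=> e b n; rewrite len_sgn_exp //; apply: leq_trans (len_exp len_len _ _) _.
by rewrite leq_mul2l; apply/orP; right; case: e; rewrite ?leq_addr ?leq_addl.
Qed.

Lemma reduced_form : exists C, forall g, B g -> exists a l,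
  [/\ A a, inside A l, sorted (nopinch F) l, g = a * ev l &
      len a + cost len l <= C * len g].
Proof.
have [K KP] := pinch_len; exists (K.+1 * C0)%N => g /B_form [a [l [Aa lA -> al]]].
have [b [m [Ab mA ms E [le _ _]]]] := reduce AFt lenMA KP Aa lA.
exists b, m; split=> //; apply: leq_trans le _.
by rewrite -mulnA leq_mul2l al orbT.
Qed.

(** Equivalently, [g] moves the vertex of [A] in the Bass-Serre tree by a distance at most [n]. *)
Definition has_form n g : Prop :=
  exists a l, [/\ A a, inside A l, size l <= n & g = a * ev l].

Lemma has_formM n k g h : has_form n g -> has_form k h -> has_form (n + k) (g * h).
Proof.
move=> [a [l [Aa lA ln ->]]] [b [m [Ab mA mk ->]]].
have [d [l' [Ad lA' sz E]]] := form_mulr AFt Ab Aa lA.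
exists d, (l' ++ m); split=> //; first by rewrite inside_cat lA'.
  by rewrite size_cat sz leq_add.
by rewrite ev_cat mulgA E !mulgA.
Qed.

Lemma has_formA a : A a -> has_form 0 a.
Proof. by move=> Aa; exists a, [::]; split; rewrite ?ev_nil ?mulg1. Qed.

Lemma has_formB g : B g -> has_form (C0 * len g) g.
Proof.
move=> /B_form [a [l [Aa lA gE le]]]; exists a, l; split=> //.
by apply: leq_trans le; apply: leq_trans (size_cost len l) (leq_addl _ _).
Qed.

Lemma has_formBV g : B g -> has_form (C0 * len g) g^-1.
Proof. by move=> /BV /has_formB; rewrite lenV. Qed.

Lemma cyc_red_has_form l n k : inside A l -> cycle (nopinch F) l -> l <> [::] ->
  has_form k (ev l ^+ n) -> n <= k.
Proof.
move=> lA lc lN [a [m [Aa mA mk]]]; rewrite -ev_rep -[ev (rep n l)]mul1g => E.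
apply: leq_trans mk.
have := reduced_size AFt A1 Aa (inside_rep n lA) mA (sorted_rep n lc) E.
by rewrite size_rep; apply: leq_trans; rewrite leq_pmulr //; case: (l) lN.
Qed.

Definition elliptic x : Prop := A x.
Definition hyperbolic x : Prop := exists l,
  [/\ inside A l, cycle (nopinch F) l, l <> [::] & x = ev l].

Lemma elliptic_or_hyperbolic x : B x -> exists g y,
  [/\ B g, x = g * y / g & elliptic y \/ hyperbolic y].
Proof.
move=> /B_form [a [l [Aa lA xE _]]]; have [lN|lN] := EM (l = [::]).
  exists 1, x; split; [by case: Bsub|by rewrite !gnorm|left].
  by rewrite xE lN ev_nil mulg1.
have [m [mA E _]] := cyclic_form AFt Aa lA lN.
have [i [b [k [il Ab kA _ alt]]]] := cyclic_reduce AFt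
  (mu := fun _ => 0) (K := 0) (fun _ _ _ _ => isT) (fun _ _ _ _ _ _ => isT) mA.
have takeA : inside A (take i m).
  by move: mA; rewrite -{1}(cat_take_drop i m) inside_cat => /andP[].
have evB n : inside A n -> B (ev n).
  by move=> nA; have := form_B A1 nA; rewrite mul1g.
rewrite xE E (ev_rot t il).
case: alt => [[_ ->]|[kN kc ->]].
  exists (a * ev (take i m)), b; split; [|by rewrite !gnorm|by left].
  by apply: BM; [exact: A_B|exact: evB].
exists (a * ev (take i m) * b), (ev k); split; [|by rewrite !gnorm|].
  by apply: BM; [apply: BM; [exact: A_B|exact: evB]|exact: A_B].
by right; exists k.
Qed.

Lemma len_quad (a b x y : G) n m : x ^+ m * a = b * y ^+ n ->
  len (x ^+ m) <= len a + len b + n * len y.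
Proof.
move=> E; have -> : x ^+ m = b * y ^+ n * a^-1 by rewrite -E mulgK.
apply: leq_trans (len_mul3 len_len _ _ _) _; rewrite lenV //.
by have := len_exp len_len y n; nlia.
Qed.

(** Powers of [x] fix a vertex, so the displacement by [z ^+ m'] bounds [m'] linearly in the short
    sides; the lengths of the sides then bound [m]. *)
Lemma rectangle_elliptic_hyperbolic x z : lin len x -> elliptic x ->
  hyperbolic z -> rectangle len B x z.
Proof.
move=> [K xK] Ax [l [lA lc lN ->]]; exists (K * (C0 * len (ev l)).+1)%N, 1%N.
split=> // h h' m m' Bh Bh' E; left.
have m'le : m' <= C0 * (len h + len h').
  apply: (cyc_red_has_form lA lc lN).
  have -> : ev l ^+ m' = h'^-1 * x ^+ m * h by rewrite -mulgA E mulKg.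
  have Axm : A (x ^+ m).
    by elim: (m) => [|k IH]; rewrite ?expg0 // expgS; exact: AM.
  have := has_formM (has_formM (has_formBV Bh') (has_formA Axm)) (has_formB Bh).
  by rewrite addn0 mulnDr addnC.
have le := len_quad E; apply: leq_trans (xK m) _.
apply: (leq_trans (leq_mul (leqnn K) le)); rewrite -mulnA -[X in _ <= _ + X]muln1.
rewrite -mulnA -mulnDr leq_mul2l; apply/orP; right.
have : m' * len (ev l) <= C0 * (len h + len h') * len (ev l) by rewrite leq_mul2r m'le orbT.
by rewrite mulSn mulnAC; nlia.
Qed.

Lemma rectangle_hyperbolic_elliptic x z : hyperbolic x -> elliptic z ->
  rectangle len B x z.
Proof.
move=> [l [lA lc lN ->]] Az; exists C0, 1%N.
split=> // h h' m m' Bh Bh' E; left.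
apply: leq_trans (leq_addr _ _); apply: (cyc_red_has_form lA lc lN).
have -> : ev l ^+ m = h' * z ^+ m' * h^-1 by rewrite -E mulgK.
have Azm : A (z ^+ m').
  by elim: (m') => [|k IH]; rewrite ?expg0 // expgS; exact: AM.
have := has_formM (has_formM (has_formB Bh') (has_formA Azm)) (has_formBV Bh).
by rewrite addn0 mulnDr addnC.
Qed.

(* [X] and [Z] translate a common axis by the same amount, so they differ by an
   edge element [d] which [Z] conjugates to [d] or to its inverse. *)
Lemma axis_translations e (Z X X0 g p q f0 f1 f2 : G) :
  (forall e, c e = 1) \/ lin len (c e) ->
  cyc (c e) f0 -> cyc (c e) f1 -> cyc (c e) f2 -> X = g * X0 / g ->
  g * p = q * f0 -> g * X0 * p = Z * q * f1 -> g * (X0 * X0) * p = Z * Z * q * f2 ->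
  X * X = Z * Z \/ exists b n d,
    [/\ lin len (c e), d = q * sgn b (c e) ^+ n / q, X = Z * d & commute Z d].
Proof.
move=> ce F0 F1 F2 XE E0 E1 E2.
have [_ FM FV] := cyc_subgroup (c e).
have gE : g^-1 = p * f0^-1 * q^-1.
  by apply: (mulgI g); rewrite mulgV !mulgA E0 !gnorm.
have [b1 [n1 a1E]] := (cycP _ _).1 (FM _ _ F1 (FV _ F0)).
have [b2 [n2 a2E]] := (cycP _ _).1 (FM _ _ F2 (FV _ F1)).
set d := q * (f1 / f0) / q.
have XZ : X = Z * d by rewrite XE gE /d !mulgA E1.
have X2 : X * X = Z * Z * q * f2 / f0 / q.
  transitivity (g * (X0 * X0) * g^-1); first by rewrite XE !gnorm.
  by rewrite gE !mulgA -[g * X0 * X0]mulgA E2.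
have Zd : Z^-1 * d * Z = q * (f2 / f1) / q.
  apply: (mulIg d); apply: (mulgI Z).
  transitivity (Z^-1 * (X * X)); first by rewrite XZ !gnorm.
  by rewrite X2 /d !gnorm.
case: ce => [c1|cl].
  left; rewrite XZ /d a1E c1; have -> : sgn b1 1 = 1 :> G by case: (b1); rewrite /= ?invg1.
  by rewrite expg1n !gnorm.
have nE : n1 = n2.
  apply: (exp_sgn_conj_inj len_len (x := q^-1 * Z^-1 * q) cl (b := b1) (b' := b2)).
  rewrite -a1E -a2E; transitivity (q^-1 * (Z^-1 * d * Z) * q).
    by rewrite /d !gnorm.
  by rewrite Zd !gnorm.
have [bE|bN] := eqVneq b1 b2.
  right; exists b1, n1, d; split=> //; first by rewrite /d a1E.
  apply: (mulgI Z^-1); rewrite mulKg mulgA Zd a2E -bE -nE -a1E; rewrite /d.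
  by [].
(* Here [Z] inverts [d], so that [Z * d] and [Z] have the same square. *)
left; rewrite XZ.
have d_inv : Z^-1 * d * Z = d^-1.
  rewrite Zd /d a1E a2E -nE; have -> : b2 = ~~ b1 by case: (b1) (b2) bN => -[].
  by rewrite sgnN expVgn !gnorm.
transitivity (Z * Z * (Z^-1 * d * Z) * d); first by rewrite !gnorm.
by rewrite d_inv !gnorm.
Qed.

Lemma rectangle_hyperbolic x z : hyperbolic x -> hyperbolic z ->
  rectangle len B x z.
Proof.
move=> [l [lA lc lN xE]] [v [vA vc vN zE]].
(* These are the translation lengths, so [x ^+ s] and [z ^+ k] move along their axes by the same
   amount [k * s]. *)
pose k := size l; pose s := size v.
have k0 : 0 < k by rewrite /k; case: (l) lN.
have s0 : 0 < s by rewrite /s; case: (v) vN.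
have [K KP] : exists K, forall e, lin len (c e) -> forall n, n <= K * len (c e ^+ n).
  case: c_lin => [c1|/c_lin_uniform [K KP]]; last by exists K => e _.
  exists 0 => e [K /(_ 1%N)]; rewrite c1 expg1n (len1 len_len) muln0.
  by [].
suff [C CP] : exists C, forall h h' m m', B h -> B h' -> x ^+ m * h = h' * z ^+ m' ->
    m <= C * (len h + len h') + C \/ x ^+ (2 * s) * h' = h' * z ^+ (2 * k).
  exists C, (2 * s)%N; split=> [|h h' m m' Bh Bh' E]; first by rewrite muln_gt0.
  have [|E2] := CP _ _ _ _ Bh Bh' E; [by left|right; exists (2 * k)%N].
  apply: (mulgI (x ^+ m)); rewrite !mulgA E -expgnDr addnC expgnDr -mulgA E.
  by rewrite mulgA E2 -!mulgA -!expgnDr addnC.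
pose C1 := (K * (2 * C0 * len z + 1) * s + 3 * C0)%N.
pose C2 := (K * (s * k * len z + s * len x) * s + s + 2 * k * s)%N.
exists (C1 + C2) => h h' m m' Bh Bh' E.
pose n := (C0 * (len h + len h'))%N.
(* Beyond this bound the common part of the axes contains an edge together with its translates by
   one and two periods [k * s]. *)
have [mle|mgt] := leqP m (3 * n + 2 * s * k).
  left; apply: leq_trans mle _; apply: (@leq_trans (C1 * (len h + len h') + C2)); last by nnia.
  rewrite /n; apply: leq_add; last by rewrite /C2; move: (K * _ * _)%N => y; nnia.
  by rewrite mulnA leq_mul2r /C1 leq_addl orbT.
have F1 := conj_flip E.
have [d [dl [Ad dlA dn dE]]] := has_formBV Bh'.
have [a [al [Aa alA an aE]]] := has_formBV Bh.
rewrite dE aE xE zE -!ev_rep in F1.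
have lsz : size (rep m l) = (m * k)%N by rewrite size_rep.
have vsz : size (rep m' v) = (m' * s)%N by rewrite size_rep.
have [| | |w [w1 w2 w3 w4 ov]] := overlap AFt (n := n) (inside_rep m lA) (sorted_rep m lc)
   (inside_rep m' vA) (sorted_rep m' vc) Ad dlA Aa alA _ _ _ F1.
- by apply: leq_trans dn _; rewrite /n leq_mul2l leq_addl orbT.
- by apply: leq_trans an _; rewrite /n leq_mul2l leq_addr orbT.
- by rewrite lsz; nnia.
rewrite lsz vsz in w1 w2 w3 w4 ov.
have [i0 i0E] : exists i0, i0 + m * k = n + w by exists (n + w - m * k); nlia.
set pu := ev (take n (rep m l)); set pv := ev (take i0 (rep m' v)).
set e := (nth (false, 1) (rep m l) n).1.
have ovi i : i <= 2 -> exists f, cyc (c (~~ e)) f /\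
    h'^-1 * x ^+ (s * i) * pu = z ^+ (k * i) * pv * f.
  move=> i2; pose j := (s * i * k + n)%N; pose i' := (k * i * s + i0)%N.
  have ski : s * i * k <= 2 * s * k.
    by rewrite [(s * i)%N]mulnC -!mulnA leq_mul2r i2 orbT.
  have mmk : m <= m * k by rewrite leq_pmulr.
  have kisE : (k * i * s = s * i * k)%N by rewrite mulnC mulnA mulnAC.
  have jm : j < m * k by rewrite /j; nlia.
  have i'm : i' + n < m' * s by rewrite /i' kisE; nlia.
  have [||sE Ff] := ov i' j _ _ i'm; first by rewrite /i' /j kisE; nlia.
    by rewrite jm andbT /j leq_addl.
  set f := _ * _ in Ff; exists f.
  have jE : (nth (false, 1) (rep m l) j).1 = e by rewrite /e /j nth_rep.
  split; first by rewrite jE in Ff.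
  have uE : ev (take j (rep m l)) = ev l ^+ (s * i) * pu.
    by rewrite /j take_rep ?ev_cat ?ev_rep //; exact: ltnW.
  have vE : ev (take i' (rep m' v)) = ev v ^+ (k * i) * pv.
    rewrite /i' take_rep ?ev_cat ?ev_rep //.
    by apply: leq_trans (leq_addr n _) (ltnW i'm).
  by rewrite /f uE vE -dE xE zE mulVKg mulgA.
have [f0 [F0 E0]] := ovi 0 isT; have [f1 [Ff1 E1]] := ovi 1%N isT.
have [f2 [Ff2 E2]] := ovi 2 isT.
rewrite !muln0 !expg0 mulg1 mul1g in E0; rewrite !muln1 in E1.
rewrite !muln2 -!addnn !expgnDr in E2.
have ce : (forall e, c e = 1) \/ lin len (c (~~ e)).
  by case: c_lin => [c1|cl]; [left|right].
have concl : (h'^-1 * x ^+ s / h'^-1) * (h'^-1 * x ^+ s / h'^-1) =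
    z ^+ k * z ^+ k -> x ^+ (2 * s) * h' = h' * z ^+ (2 * k).
  rewrite [(2 * s)%N]mulnC [(2 * k)%N]mulnC !muln2 -!addnn !expgnDr => <-.
  by rewrite !gnorm.
have := axis_translations ce F0 Ff1 Ff2 erefl E0 E1 E2.
case=> [/concl ?|[b [n1 [dd [cl ddE XZ Zdd]]]]].
  by right.
case: n1 ddE => [|n1] ddE.
  right; apply: concl; have dd1 : dd = 1 by rewrite ddE expg0 mulg1 mulgV.
  by rewrite XZ dd1 mulg1.
left.
(* As [Z] commutes with [dd], the power [dd ^+ r] is the quotient of the two translations by [r]
   periods; the rectangle shows it to be short, while [dd] is conjugate to a nontrivial power of an
   edge generator. *)
pose r := m %/ s; pose q := m %% s.
have mE : m = (r * s + q)%N by exact: divn_eq.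
have qs : q < s by exact: ltn_pmod.
have ddr : dd ^+ r = z ^- (k * r) * z ^+ m' * (h^-1 * x ^- q * h').
  apply: (mulgI (z ^+ (k * r))); rewrite [in LHS]expgnA -expgMn // -XZ.
  rewrite conjg_expE -expgnA invgK !mulgA mulgV mul1g -(conj_flip E).
  by rewrite mE mulnC expgnDr !gnorm.
have len_dd : len (dd ^+ r) <= (2 * n + s * k) * len z + (len h + len h' + s * len x).
  rewrite ddr; apply: leq_trans (lenM len_len _ _) _; apply: leq_add.
    apply: leq_trans (len_exp_diff len_len _ _ _) _; rewrite leq_mul2r.
    apply/orP; right; rewrite -(leq_pmul2r s0).
    have mk1 : m * k <= k * r * s + s * k.
      have : q * k <= s * k by rewrite leq_mul2r ltnW ?orbT.
      by rewrite mE mulnDl [(k * r)%N]mulnC mulnAC; nlia.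
    have mk2 : k * r * s <= m * k.
      by rewrite mE mulnDl [(k * r)%N]mulnC mulnAC leq_addr.
    have ns : 2 * n + s * k <= (2 * n + s * k) * s by rewrite leq_pmulr.
    by apply: leq_trans ns; rewrite mulnDl !mulnBl; nlia.
  apply: leq_trans (len_mul3 len_len _ _ _) _.
  rewrite !(lenV len_len); have := len_exp len_len x q.
  have : q * len x <= s * len x by rewrite leq_mul2r ltnW ?orbT.
  by nlia.
have rle : r <= K * len (dd ^+ r).
  apply: (@leq_trans (n1.+1 * r)); first by rewrite leq_pmull.
  rewrite ddE conjg_expE -expgnA; apply: (lin_conj len_len) => j.
  by rewrite (len_sgn_exp len_len); exact: KP.
have R_le : r <= K * ((2 * n + s * k) * len z + (len h + len h' + s * len x)).
  by apply: leq_trans rle _; rewrite leq_mul2l len_dd orbT.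
have m_le : m <= K * ((2 * n + s * k) * len z + (len h + len h' + s * len x)) * s + s.
  by rewrite mE; apply: leq_add; [rewrite leq_mul2r R_le orbT|exact: ltnW].
apply: leq_trans m_le _; rewrite /C1 /C2 /n.
by move: (len h + len h')%N (len x) (len z) => L lx lz; clear; nia.
Qed.

Hypothesis rectangle_A : forall x z, A x -> A z -> lin len x -> lin len z ->
  rectangle len A x z.

(* The rectangle is cut by the stable letters of its short sides into
   rectangles in A whose long sides are powers of edge generators; the weights
   make the resulting powers match along the cuts. *)
Lemma rectangle_elliptic x z : lin len x -> lin len z -> elliptic x ->
  elliptic z -> rectangle len B x z.
Proof.
move=> lx lz Ax Az; pose T : finType := (bool + bool * bool)%type.
(* The family consists of [x], [z] and the signed edge generators; if the edge groups are trivial,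
   the places of the latter are filled with [x]. *)
have [f [fx fz fA fl fc]] : exists f : T -> G, [/\ f (inl true) = x,
    f (inl false) = z, forall i, A (f i), forall i, lin len (f i) &
    (forall e, c e = 1) \/ forall e b, f (inr (e, b)) = sgn b (c e)].
  case: c_lin => [c1|cl].
    exists (fun i => if i is inl false then z else x); split=> //; last by left.
      by case=> [[]|[]].
    by case=> [[]|[]].
  exists (fun i => match i with
    | inl true => x | inl false => z | inr (e, b) => sgn b (c e) end).
  split=> //; last by right.
    by case=> [[]|[e b]] //; have := A_c e b 1; rewrite expg1.
  by case=> [[]|[e b]] //; exact: lin_sgn.
have [C [N [N0 CN NW]]] := rectangle_weights len_len fl
  (fun i j => rectangle_A (fA i) (fA j) (fl i) (fl j)).
pose Lm := \max_i len (f i).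
have f_len i m S : m <= C * S + C -> len (f i ^+ m) <= (C * Lm + 1) * S + (C * Lm + 1).
  move=> mS; apply: leq_trans (len_exp len_len _ _) _.
  apply: (@leq_trans ((C * S + C) * Lm)).
    by apply: leq_mul => //; exact: (leq_bigmax (F := fun i => len (f i))).
  by move: Lm => y; clear; nia.
set K1 := (C * Lm + 1)%N in f_len.
have K11 : 0 < K1 by rewrite /K1 addn1.
(* Induction along the stable letters of one short side: the first cut produces a power of an edge
   generator, which is a long side of the next rectangle. *)
have chain : forall l a l' a' i m m', A a -> A a' -> inside A l -> inside A l' ->
    sorted (nopinch F) l -> sorted (nopinch F) l' ->
    f i ^+ m * (a * ev l) = a' * ev l' * z ^+ m' ->
  len (f i ^+ m) <= K1 * (len a + cost len l + (len a' + cost len l')) + K1 \/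
  f i ^+ N i * (a * ev l) = a * ev l * z ^+ N (inl false).
  have Aexp g k : A g -> A (g ^+ k).
    by move=> Ag; elim: k => [|k IH]; rewrite ?expg0 // expgS; exact: AM.
  elim=> [|[e k] l IH] a l' a' i m m' Aa Aa' lA lA' ls ls' E.
    case: l' lA' ls' E => [|q l'] lA' ls' E.
      move: E; rewrite ev_nil !mulg1 -fz => /(CN _ _ _ _ _ _ Aa Aa') [|->]; last by right.
      by move=> /f_len; rewrite cost_nil !addn0; left.
    exfalso; have [b [r [Ab rA rs rE [sz ag]]]] :=
      reduced_mulr AFt A1 lA' ls' (Aexp _ m' Az).
    have ag' : agree (size (q :: l')) (q :: l') b r by apply: ag; right.
    have Ab' : A (a'^-1 * f i ^+ m * a).
      by apply: AM => //; apply: AM; [exact: AV|exact: Aexp].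
    have [|sz' _] := reduced_eq AFt Ab' Ab lA rA ls rs.
      rewrite -rE ev_nil mul1g mulg1; apply: (mulgI a').
      by rewrite [RHS]mulgA -E ev_nil mulg1 !gnorm.
    by case: ag' => // -[_]; rewrite -sz'.
  have [b [r [Ab rA rs rE [sz ag]]]] := reduced_mulr AFt A1 lA' ls' (Aexp _ m' Az).
  have Ab' : A (a'^-1 * f i ^+ m * a).
    by apply: AM => //; apply: AM; [exact: AV|exact: Aexp].
  have [|sz' edges] := reduced_eq AFt Ab' Ab lA rA ls rs.
    rewrite -rE mul1g; apply: (mulgI a'); rewrite [RHS]mulgA -E !gnorm.
    by [].
  case: l' lA' ls' E ag sz {rE} => [|[e' k'] l'] lA' ls' E ag sz.
    by move: sz; rewrite -sz'.
  have [//|[b1 _ _ /(_ 0 isT) sg]] : agree (size ((e', k') :: l')) ((e', k') :: l') b r.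
    by apply: ag; right.
  have [//|/= eE] := edges 0.
  rewrite b1 !take0 ev_nil !mulg1 invg1 mul1g => Fphi.
  have ee' : e' = e by rewrite eE sg.
  subst e'; set phi := a'^-1 * f i ^+ m * a in Fphi Ab'.
  have fE : f i ^+ m * a = a' * phi by rewrite /phi !gnorm.
  have [d [n phiE]] := (cycP _ _).1 Fphi.
  set phi' := sgn d (c e) ^+ n.
  have phiE' : phi * ltr e = ltr e * phi' by rewrite phiE ltr_c_exp.
  have E' : phi' * (k * ev l) = k' * ev l' * z ^+ m'.
    apply: (mulgI (a' * ltr e)); move: E; rewrite !ev_cons /= => E.
    transitivity (a' * (ltr e * phi') * k * ev l); first by rewrite !gnorm.
    rewrite -phiE'; transitivity (f i ^+ m * a * ltr e * k * ev l).
      by rewrite fE !gnorm.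
    by move: E; rewrite !mulgA.
  have /inside_cons [/= Ak lA1] := lA.
  have /inside_cons [/= Ak' lA1'] := lA'.
  rewrite !cost_cons /=.
  have small : len phi' <= K1 * (len k + cost len l + (len k' + cost len l')) + K1 ->
      len (f i ^+ m) <= K1 * (len a + ((len k).+1 + cost len l) +
        (len a' + ((len k').+1 + cost len l'))) + K1.
    move=> le; have -> : f i ^+ m = a' * phi * a^-1 by rewrite -fE mulgK.
    have := len_mul3 len_len a' phi a^-1; rewrite (lenV len_len).
    have -> : phi = ltr e * phi' * (ltr e)^-1 by rewrite -phiE' mulgK.
    have := len_mul3 len_len (ltr e) phi' (ltr e)^-1; rewrite (lenV len_len).
    have := len_ltr e; move: le; clear - K11.
    move: (len phi') (len (ltr e)) (len (_ * _ * _)) (len (_ * _ * _)).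
    move: (len a) (len k) (len k') (len a') (cost _ _) (cost _ _); nia.
  case: fc => [c1|fc].
    left; apply: small; rewrite /phi' c1; have -> : sgn d 1 = 1 :> G.
      by case: (d); rewrite /= ?invg1.
    by rewrite expg1n (len1 len_len).
  rewrite /phi' -fc in E' small.
  have [le|comm] := IH _ _ _ _ _ _ Ak Ak' lA1 lA1' (path_sorted ls) (path_sorted ls') E'.
    by left; apply: small.
  rewrite phiE -fc in fE.
  have [/(f_len i) le|comm_a] := CN _ _ _ _ _ _ Aa Aa' fE.
    by left; apply: leq_trans le _; rewrite leq_add2r leq_mul2l; apply/orP; right; nlia.
  right.
  (* The two generators are conjugate by the stable letter, so their weights agree and the powers
     match across the cut. *)
  have NE : N (inr (e, d)) = N (inr (~~ e, d)).
    have [|g gE] := NW (inr (~~ e, d)) (inr (e, d)) (ltr e) 1%N 1%N isT.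
      by rewrite !fc; exact: ltr_c_exp.
    apply/esym; apply: (exp_conj_inj len_len (fl (inr (e, d))) (x := g^-1 * ltr e)).
    have fcE : f (inr (~~ e, d)) ^+ N (inr (~~ e, d)) =
        ltr e * f (inr (e, d)) ^+ N (inr (~~ e, d)) / ltr e.
      by rewrite !fc c_exp_conj.
    transitivity (g^-1 * (f (inr (~~ e, d)) ^+ N (inr (~~ e, d)) * g)).
      by rewrite fcE !gnorm.
    by rewrite gE mulKg.
  rewrite ev_cons /= -!mulgA !mulgA.
  transitivity (a * (f (inr (~~ e, d)) ^+ N (inr (~~ e, d)) * ltr e) * (k * ev l)).
    by rewrite !mulgA -comm_a.
  rewrite -NE fc ltr_c_exp -fc; transitivity (a * ltr e * (f (inr (e, d)) ^+ N (inr (e, d)) * (k * ev l))).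
    by rewrite !mulgA.
  by rewrite comm !mulgA.
have [C1 red] := reduced_form; have [K xK] := lx.
exists (K * K1 * C1 + K * K1)%N, (N (inl true)); split=> // h h' m m' Bh Bh' E.
have [a [l [Aa lA ls hE le]]] := red _ Bh.
have [a' [l' [Aa' lA' ls' hE' le']]] := red _ Bh'.
rewrite hE hE' -fx in E; have [le2|comm] := chain _ _ _ _ _ _ _ Aa Aa' lA lA' ls ls' E; last first.
  by right; exists (N (inl false)); rewrite hE -fx.
left; apply: leq_trans (xK m) _; rewrite fx in le2.
apply: leq_trans (leq_mul (leqnn K) le2) _.
have : len a + cost len l + (len a' + cost len l') <= C1 * (len h + len h').
  by rewrite mulnDr leq_add.
move: (_ + (_ + _))%N (len h + len h')%N; clear => y w yw.
have : K * K1 * y <= K * K1 * (C1 * w) by rewrite leq_mul2l yw orbT.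
by rewrite !mulnDr !mulnDl !mulnA; nia.
Qed.

Lemma rectangle_ext x z : B x -> B z -> lin len x -> lin len z -> rectangle len B x z.
Proof.
move=> /elliptic_or_hyperbolic [g [x' [Bg -> ex]]].
move=> /elliptic_or_hyperbolic [g' [z' [Bg' -> ez]]] lx lz.
have {}lx : lin len x'.
  by have := lin_conjugate len_len g^-1 lx; rewrite !gnorm.
have {}lz : lin len z'.
  by have := lin_conjugate len_len g'^-1 lz; rewrite !gnorm.
apply: rectangle_conj => //; case: ex ez => [Ax|hx] [Az|hz].
- exact: rectangle_elliptic.
- exact: rectangle_elliptic_hyperbolic.
- exact: rectangle_hyperbolic_elliptic.
- exact: rectangle_hyperbolic.
Qed.

(** * Conjugacy in an HNN extension *)

Lemma ev_B l : inside A l -> B (ev l).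
Proof. by move=> lA; have := form_B A1 lA; rewrite mul1g. Qed.

Lemma inside_take i l : inside A l -> inside A (take i l).
Proof. by rewrite -{1}(cat_take_drop i l) inside_cat => /andP[]. Qed.

Lemma cost_take (mu : G -> nat) i l : cost mu (take i l) <= cost mu l.
Proof. by rewrite -{2}(cat_take_drop i l) cost_cat leq_addr. Qed.

Lemma cyclic_reduce_len : exists C, forall u, B u -> exists g y,
  [/\ B g, u = g * y / g, len g <= C * len u &
    A y /\ len y <= C * len u \/
    exists l, [/\ inside A l, cycle (nopinch F) l, l <> [::], y = ev l &
                   cost len l <= C * len u]].
Proof.
have [K KP] := pinch_len; pose C := (K.+1.*2 * C0 + C0.*2)%N.
exists C.+1 => u Bu; have [a [l [Aa lA uE le]]] := B_form Bu.
have [lN|lN] := EM (l = [::]).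
  exists 1, u; split; [by case: Bsub|by rewrite !gnorm|by rewrite (len1 len_len)|].
  by left; split; [rewrite uE lN ev_nil mulg1|exact: leq_pmull].
have [m [mA E cm]] := cyclic_form AFt Aa lA lN.
have {}cm := leq_trans (cm len lenMA) le.
have [i [b [k [il Ab kA bk alt]]]] := cyclic_reduce AFt lenMA KP mA.
rewrite (len1 len_len) add0n in bk.
have bkC : len b + cost len k <= K.+1.*2 * C0 * len u.
  by apply: leq_trans bk _; rewrite -mulnA leq_mul2l cm orbT.
have tm : len (ev (take i m)) <= C0 * len u.
  apply: leq_trans (len_ev (fun _ _ => leqnn _) (inside_take i mA)) _.
  exact: leq_trans (cost_take _ _ _) cm.
have la : len a <= C0 * len u by apply: leq_trans le; exact: leq_addr.
have CE : (C.+1 * len u = K.+1.*2 * C0 * len u + C0 * len u + C0 * len u + len u)%N.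
  by rewrite /C; move: (K.+1.*2) (len u); clear; nia.
have am : len (a * ev (take i m)) <= C0 * len u + C0 * len u.
  by apply: leq_trans (lenM len_len _ _) _; exact: leq_add.
have Bam : B (a * ev (take i m)) by apply: form_B => //; exact: inside_take.
rewrite CE; case: alt => [[kN bE]|[kN kc bE]].
  exists (a * ev (take i m)), b; split=> //.
  - by rewrite uE E (ev_rot t il) bE !gnorm.
  - by apply: leq_trans am _; nlia.
  - by left; split=> //; nlia.
exists (a * ev (take i m) * b), (ev k); split=> //.
- by apply: BM => //; exact: A_B.
- by rewrite uE E (ev_rot t il) bE !gnorm.
- by apply: leq_trans (lenM len_len _ _) _; nlia.
- by right; exists k; split=> //; nlia.
Qed.

Definition conj_bounded (D : G -> Prop) : Prop := exists C, forall u v g,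
  D u -> D v -> D g -> g * u / g = v ->
  exists d, d * u / d = v /\ len d <= C * (len u + len v) + C.

Lemma prefix_rep i r l : l <> [::] -> i <= r * size l -> exists q j,
  j < size l /\ ev (take i (rep r l)) = ev l ^+ q * ev (take j l).
Proof.
move=> lN ir; have l0 : 0 < size l by case: (l) lN.
exists (i %/ size l), (i %% size l); split; first exact: ltn_pmod.
rewrite {1}(divn_eq i (size l)) take_rep -?divn_eq // ev_cat ev_rep.
congr (_ * ev _); case: r ir => [|r] ir.
  by move: ir; rewrite mul0n leqn0 => /eqP ->; rewrite mod0n !take0.
by rewrite repS takel_cat // ltnW // ltn_pmod.
Qed.

(** [g] carries one axis to the other. An edge common to both gives an edge element between prefixes
    of the periodic forms, and whole periods are dropped since they commute with [ev l] or
    [ev l']. *)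
Lemma hyperbolic_conj l l' g : inside A l -> inside A l' ->
    cycle (nopinch F) l -> cycle (nopinch F) l' -> l <> [::] -> l' <> [::] ->
    B g -> g * ev l / g = ev l' ->
  exists j j' e b n (f := sgn b (c e) ^+ n),
    (ev (take j' l') * f / ev (take j l)) * ev l /
    (ev (take j' l') * f / ev (take j l)) = ev l'.
Proof.
move=> lA lA' lc lc' lN lN' Bg E.
have l0 : 0 < size l by case: (l) lN.
have l0' : 0 < size l' by case: (l') lN'.
pose n := (C0 * len g)%N; pose r := (3 * n).+1.
have [d [m [Ad mA mn gE]]] := has_formB Bg.
have E1 : d * ev m * ev (rep r l) = ev (rep r l') * (d * ev m).
  by rewrite -gE !ev_rep -E conjg_expE !gnorm.
have usz : size (rep r l) = (r * size l)%N by rewrite size_rep.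
have vsz : size (rep r l') = (r * size l')%N by rewrite size_rep.
have r1 : r <= r * size l by rewrite leq_pmulr.
have r1' : r <= r * size l' by rewrite leq_pmulr.
have nu : n <= size (rep r l) by rewrite usz; apply: leq_trans r1; rewrite /r; nlia.
have [w [w1 w2 w3 w4 ov]] := overlap AFt (inside_rep r lA) (sorted_rep r lc)
  (inside_rep r lA') (sorted_rep r lc') Ad mA Ad mA mn mn nu E1.
rewrite usz vsz in w1 w2 w3 w4 ov.
pose i := (n + w - r * size l)%N.
have [|||_] := ov i n; rewrite /i /r in r1 r1' *; [nlia|rewrite leqnn /=; nlia|nlia|].
rewrite -/r -/i -gE; set e := (nth _ _ _).1.
have [|q [j [_ ->]]] := @prefix_rep n r l lN; first by rewrite -usz.
have [|q' [j' [_ ->]]] := @prefix_rep i r l' lN'; first by rewrite /i /r in r1 r1' w1 *; nlia.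
case/cycP=> b [k fE]; exists j, j', (~~ e), b, k; rewrite /= -fE.
set p := ev (take j l); set p' := ev (take j' l').
have -> : p' * ((ev l' ^+ q' * p')^-1 * (g * (ev l ^+ q * p))) / p =
    ev l' ^- q' * g * ev l ^+ q by rewrite !gnorm.
have com : ev l ^+ q * ev l / ev l ^+ q = ev l by rewrite -expgSr expgS mulgK.
have com' : ev l' ^- q' * ev l' * ev l' ^+ q' = ev l'.
  by rewrite -mulgA -expgS expgSr mulKg.
transitivity (ev l' ^- q' * (g * (ev l ^+ q * ev l / ev l ^+ q) / g) * ev l' ^+ q').
  by rewrite !gnorm.
by rewrite com E com'.
Qed.

Definition A_conj (u v : G) : Prop := exists d, A d /\ d * u / d = v.

Lemma A_conj_sym u v : A_conj u v -> A_conj v u.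
Proof. by move=> [d [Ad <-]]; exists d^-1; split; [exact: AV|rewrite !gnorm]. Qed.

Definition edge_power (n : nat) (p : bool * bool) : G := sgn p.2 (c p.1) ^+ n.

(** The stable letter swaps the two edge generators and keeps the sign, so the graph has four
    vertices. *)
Definition edge_step (n : nat) (p q : bool * bool) : bool :=
  `[< A_conj (edge_power n p) (edge_power n q) >] || (q == (~~ p.1, p.2)).

(** Rigidity keeps the exponent constant along a chain of conjugations. *)
Lemma edge_power_conj n k p q u : (forall e, lin len (c e)) ->
  u * edge_power n p / u = edge_power k q -> n = k.
Proof.
case: p q => [e b] [e' b'] cl; rewrite /edge_power /=.
have [<-|ne] := eqVneq e e'; first exact: (exp_sgn_conj_inj len_len (cl e)).
have -> : e' = ~~ e by case: (e) (e') ne => -[].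
rewrite -c_exp_conj => E.
apply: (exp_sgn_conj_inj len_len (x := (ltr e)^-1 * u) (cl e) (b := b) (b' := b')).
transitivity ((ltr e)^-1 * (u * sgn b (c e) ^+ n / u) * ltr e); first by rewrite !gnorm.
by rewrite E !gnorm.
Qed.

(* Collins' lemma for elliptic elements. *)
Lemma elliptic_conj g u v : B g -> A u -> A v -> g * u / g = v ->
  A_conj u v \/ (forall e, lin len (c e)) /\ exists n p q,
    [/\ A_conj v (edge_power n p), connect (edge_step n) p q &
        A_conj (edge_power n q) u].
Proof.
move=> Bg Au; have [C red] := reduced_form.
have [a [l [Aa lA ls -> _]]] := red _ Bg.
elim: l a v Aa lA ls {g Bg} => [|[e k] l IH] a v Aa lA ls Av E.
  by left; exists a; move: E; rewrite ev_nil mulg1.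
have [b [r [Ab rA rs rE [_ ag]]]] := reduced_mulr AFt A1 lA ls Au.
have Ab' : A (a^-1 * v * a) by apply: AM => //; apply: AM => //; exact: AV.
have [|sz edges] := reduced_eq AFt Ab' Ab lA rA ls rs.
  by rewrite -rE -E !gnorm.
have [//|[b1 _ _ _]] : agree (size ((e, k) :: l)) ((e, k) :: l) b r.
  by apply: ag; right.
have [//|/= _] := edges 0.
rewrite b1 !take0 ev_nil !mulg1 invg1 mul1g => Fphi.
have [d [n phiE]] := (cycP _ _).1 Fphi.
case: c_lin => [c1|cl].
  left; exists 1; split=> //; have v1 : v = 1.
    apply: (mulgI a^-1); apply: (mulIg a); rewrite phiE c1 mulg1 mulVg.
    by have -> : sgn d 1 = 1 :> G; [case: (d); rewrite /= ?invg1|rewrite expg1n].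
  rewrite invg1 mul1g mulg1 v1; apply: (mulgI (a * ev ((e, k) :: l))).
  by apply: (mulIg (a * ev ((e, k) :: l))^-1); rewrite E v1 mulg1 mulgV.
have /inside_cons [/= Ak lA1] := lA.
have Ac' : A (sgn d (c e) ^+ n) by exact: A_c.
have vp : A_conj v (edge_power n (~~ e, d)).
  by exists a^-1; split; [exact: AV|rewrite invgK phiE].
have E' : (k * ev l) * u / (k * ev l) = sgn d (c e) ^+ n.
  have -> : sgn d (c e) ^+ n = (ltr e)^-1 * sgn d (c (~~ e)) ^+ n * ltr e.
    by rewrite -c_exp_conj !gnorm.
  by rewrite -phiE -E ev_cons /= !gnorm.
have st : edge_step n (~~ e, d) (e, d) by rewrite /edge_step /= negbK eqxx orbT.
right; split=> //.
have [uc|[_ [n' [p [q [vp' pq qu]]]]]] := IH _ _ Ak lA1 (path_sorted ls) Ac' E'.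
  by exists n, (~~ e, d), (e, d); split=> //; [exact: connect1|exact: A_conj_sym].
have nn : n' = n.
  have [x [_ xE]] := vp'; apply/esym; apply: (edge_power_conj cl (p := (e, d)) xE).
subst n'; exists n, (~~ e, d), q; split=> //.
apply: connect_trans (connect1 st) _; apply: connect_trans pq; apply: connect1.
by rewrite /edge_step; apply/orP; left; apply/asboolP.
Qed.

Let Lc := (len (c true) + len (c false))%N.

Lemma len_c_exp e b n : len (sgn b (c e) ^+ n) <= n * Lc.
Proof.
rewrite len_sgn_exp //; apply: leq_trans (len_exp len_len _ _) _.
by rewrite leq_mul2l; apply/orP; right; case: e; rewrite ?leq_addr ?leq_addl.
Qed.

Hypothesis conj_A : conj_bounded A.

(* A shortest chain of conjugations between the four powers of the edge
   generators has bounded length. *)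
Lemma elliptic_conj_bounded : exists C, forall u v g, B g -> A u -> A v ->
  g * u / g = v -> exists d, d * u / d = v /\ len d <= C * (len u + len v) + C.
Proof.
have [CA AC] := conj_A.
have {}AC u v : A u -> A v -> A_conj u v -> exists d,
    d * u / d = v /\ len d <= CA * (len u + len v) + CA.
  by move=> Au Av [d [Ad E]]; exact: AC E.
have [K KP] : exists K, (forall e, lin len (c e)) -> forall e n, n <= K * len (c e ^+ n).
  have [/c_lin_uniform [K KP]|nl] := EM (forall e, lin len (c e)); first by exists K.
  by exists 0.
exists (20 * ((CA + 1) * (K * Lc + 1)))%N => u v g Bg Au Av E.
have [/AC [//|//|d [dE le]]|[cl [n [p [q [vp pq qu]]]]]] := elliptic_conj Bg Au Av E.
  exists d; split=> //; apply: leq_trans le _.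
  by move: (len u + len v)%N => w; clear; nia.
have len_ep k s : len (edge_power k s) <= k * Lc by exact: len_c_exp.
have A_ep k s : A (edge_power k s) by exact: A_c.
(* The bound holds for conjugates of edge powers with the same constant [K], whatever the
   conjugator. *)
have nv : n <= K * len v.
  have [d [_ dE]] := vp.
  have -> : v = d^-1 * edge_power n p / d^-1 by rewrite -dE !gnorm.
  by apply: (lin_conj len_len) => j; rewrite (len_sgn_exp len_len); exact: KP.
pose D := (CA * (n * Lc + n * Lc) + CA + 1)%N.
have conj_path s p' : path (edge_step n) p' s -> exists d,
    d * edge_power n p' / d = edge_power n (last p' s) /\ len d <= size s * D.
  elim: s p' => [|r s IH] p' /=.
    by exists 1; rewrite mul1g invg1 mulg1 (len1 len_len).
  case/andP=> st /IH [d [dE le]].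
  have [d' [d'E le']] : exists d', d' * edge_power n p' / d' = edge_power n r /\ len d' <= D.
    case/orP: st => [/asboolP /AC [//|//|d' [d'E le']]|/eqP ->].
      exists d'; split=> //; apply: leq_trans le' _; rewrite /D -addnA leq_add //.
        by rewrite leq_mul2l leq_add ?orbT.
      exact: leq_addr.
    exists (ltr p'.1); rewrite c_exp_conj; split=> //.
    by apply: leq_trans (len_ltr _) _; rewrite /D leq_addl.
  exists (d * d'); split; first by rewrite -dE -d'E !gnorm.
  by apply: leq_trans (lenM len_len _ _) _; rewrite mulSn addnC leq_add.
have {pq}[d2 [d2E le2]] : exists d,
    d * edge_power n p / d = edge_power n q /\ len d <= 4 * D.
  (* A path without repetitions among four vertices is short, independently of [n]. *)
  case/connectP: pq => s ps ->; case/shortenP: ps => s' ps' us' _.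
  have [d [dE le]] := conj_path _ _ ps'; exists d; split=> //.
  apply: leq_trans le _; rewrite leq_mul2r; apply/orP; right.
  have := max_card (mem (p :: s')); rewrite (card_uniqP us') card_prod card_bool.
  exact: ltnW.
have [d1 [d1E le1]] := AC _ _ Av (A_ep _ _) vp.
have [d3 [d3E le3]] := AC _ _ (A_ep _ _) Au qu.
exists (d3 * d2 * d1)^-1; split.
  by rewrite -d3E -d2E -d1E !gnorm.
rewrite (lenV len_len); apply: leq_trans (len_mul3 len_len _ _ _) _.
have nL : n * Lc <= K * Lc * len v by rewrite [(K * Lc)%N]mulnC -mulnA [X in _ <= X]mulnC leq_mul2r nv orbT.
have {}le1 : len d1 <= CA * (len v + n * Lc) + CA.
  by apply: leq_trans le1 _; rewrite leq_add2r leq_mul2l leq_add2l len_ep orbT.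
have {}le3 : len d3 <= CA * (n * Lc + len u) + CA.
  by apply: leq_trans le3 _; rewrite leq_add2r leq_mul2l leq_add2r len_ep orbT.
have le123 := leq_add (leq_add le3 le2) le1.
apply: leq_trans le123 _; rewrite /D; move: nL.
move: (n * Lc)%N (K * Lc)%N (len u) (len v) => x y lu lv; clear => xy.
have : CA * x <= CA * (y * lv) by rewrite leq_mul2l xy orbT.
nia.
Qed.

Lemma conj_bounded_ext : conj_bounded B.
Proof.
have [C1 C1P] := cyclic_reduce_len.
have [C2 C2P] := elliptic_conj_bounded.
(* This bounds the power in the hyperbolic case: [h] and [h'] are the short sides of a rectangle
   with equal long sides. *)
have [C3 C3P] : exists C, (forall e, c e = 1) \/ forall e b n h h', B h -> B h' ->
    sgn b (c e) ^+ n * h = h' * sgn b (c e) ^+ n ->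
    exists k, sgn b (c e) ^+ k * h = h' * sgn b (c e) ^+ k /\
              k <= C * (len h + len h') + C.
  case: c_lin => [c1|cl]; first by exists 0; left.
  pose f (p : bool * bool) := sgn p.2 (c p.1).
  have fl p : lin len (f p) by exact: lin_sgn.
  have fB p : B (f p) by have := A_c p.1 p.2 1; rewrite expg1 => /A_B.
  have [C [N [N0 CN _]]] := rectangle_weights len_len fl
    (fun i j => rectangle_ext (fB i) (fB j) (fl i) (fl j)).
  pose M := (\sum_p N p)%N; exists (C + M); right=> e b n h h' Bh Bh' E.
  have [le|com] := CN (e, b) (e, b) _ _ _ _ Bh Bh' E.
    exists n; split=> //; apply: leq_trans le _; rewrite mulnDl; nlia.
  set x := sgn b (c e) in E *; set P := N (e, b) in com.
  have comk k : x ^+ (P * k) * h = h * x ^+ (P * k) by exact: exp_comm.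
  (* As [x ^+ P] commutes with [h], multiples of [P] can be removed from the exponent. *)
  exists (n %% P); split.
    apply: (mulIg (x ^+ (P * (n %/ P)))); rewrite -[LHS]mulgA -comk.
    rewrite [LHS]mulgA -[RHS]mulgA -!expgnDr.
    have -> : n %% P + P * (n %/ P) = n by rewrite mulnC addnC -divn_eq.
    by rewrite E.
  have := ltn_pmod n (N0 (e, b)); rewrite -/P.
  have : P <= M by rewrite /M (bigD1 (e, b)) //= leq_addr.
  by nlia.
pose C4 := (4 * C1 + 3 * C1 * C3 * Lc + C3 * Lc)%N.
exists (2 * C1 + C1 * C2 + C2 + C4)%N => u v g0 Bu Bv Bg0 E0.
have [g [y [Bg uE lg alt]]] := C1P u Bu.
have [g' [y' [Bg' vE lg' alt']]] := C1P v Bv.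
pose h := g'^-1 * g0 * g.
have Bh : B h by apply: BM => //; apply: BM => //; exact: BV.
have hE : h * y / h = y'.
  transitivity (g'^-1 * (g0 * (g * y / g) / g0) * g'); first by rewrite /h !gnorm.
  by rewrite -uE E0 vE !gnorm.
suff [d [dE ld]] : exists d, d * y / d = y' /\
    len d <= (C1 * C2 + C2 + C4) * (len u + len v) + (C2 + C4).
  exists (g' * d * g^-1); split.
    transitivity (g' * (d * (g^-1 * u * g) / d) / g'); first by rewrite !gnorm.
    have -> : g^-1 * u * g = y by rewrite uE !gnorm.
    by rewrite dE -vE.
  apply: leq_trans (len_mul3 len_len _ _ _) _; rewrite (lenV len_len).
  have := leq_add (leq_add lg' ld) lg; move/leq_trans; apply.
  by move: (len u) (len v) (C1 * C2)%N; clear; nia.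
(* Used to exclude the mixed cases: powers of an elliptic element have bounded displacement, those
   of a hyperbolic one do not. *)
have exp_conj k : h * y ^+ k / h = y' ^+ k by rewrite -conjg_expE hE.
case: alt alt' => [[Ay ly]|[l [lA lc lN yE cl]]] [[Ay' ly']|[l' [lA' lc' lN' yE' cl']]].
- have [d [dE ld]] := C2P _ _ _ Bh Ay Ay' hE; exists d; split=> //.
  apply: leq_trans ld _; rewrite leq_add ?leq_addr //.
  have := leq_mul (leqnn C2) (leq_add ly ly'); rewrite -mulnDr => le.
  by apply: leq_trans le _; rewrite mulnA [(C2 * C1)%N]mulnC leq_mul2r -addnA leq_addr orbT.
- exfalso; pose k := (C0 * len h + 0 + C0 * len h).+1.
  have Ak : A (y ^+ k) by elim: (k) => [|j IH]; rewrite ?expg0 // expgS; exact: AM.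
  have := has_formM (has_formM (has_formB Bh) (has_formA Ak)) (has_formBV Bh).
  by rewrite exp_conj yE' => /(cyc_red_has_form lA' lc' lN'); rewrite ltnn.
- exfalso; pose k := (C0 * len h + 0 + C0 * len h).+1.
  have Ak : A (y' ^+ k) by elim: (k) => [|j IH]; rewrite ?expg0 // expgS; exact: AM.
  have := has_formM (has_formM (has_formBV Bh) (has_formA Ak)) (has_formB Bh).
  rewrite -exp_conj !gnorm yE => /(cyc_red_has_form lA lc lN).
  by rewrite ltnn.
rewrite yE yE' in hE.
have [j [j' [e [b [n /=]]]]] := hyperbolic_conj lA lA' lc lc' lN lN' Bh hE.
set p := ev (take j l); set p' := ev (take j' l') => pE.
have Bp : B p by apply: ev_B; exact: inside_take.
have Bp' : B p' by apply: ev_B; exact: inside_take.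
have lp : len p <= C1 * len u.
  apply: leq_trans (len_ev (fun _ _ => leqnn _) (inside_take j lA)) _.
  exact: leq_trans (cost_take _ _ _) cl.
have lp' : len p' <= C1 * len v.
  apply: leq_trans (len_ev (fun _ _ => leqnn _) (inside_take j' lA')) _.
  exact: leq_trans (cost_take _ _ _) cl'.
have ly : len (ev l) <= C1 * len u.
  exact: leq_trans (len_ev (fun _ _ => leqnn _) lA) cl.
have ly' : len (ev l') <= C1 * len v.
  exact: leq_trans (len_ev (fun _ _ => leqnn _) lA') cl'.
have [k [kE lk]] : exists k, (p' * sgn b (c e) ^+ k / p) * ev l /
    (p' * sgn b (c e) ^+ k / p) = ev l' /\
    len (sgn b (c e) ^+ k) <= (3 * C1 * C3 * Lc) * (len u + len v) + C3 * Lc.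
  case: C3P => [c1|C3P].
    exists n; split=> //; rewrite c1; have -> : sgn b 1 = 1 :> G.
      by case: (b); rewrite /= ?invg1.
    by rewrite expg1n (len1 len_len).
  (* The two short sides are cyclic permutations of the given forms, written as conjugates by
     prefixes. *)
  have [|||k [kE lk]] := C3P e b n (p^-1 * ev l * p) (p'^-1 * ev l' * p').
  - by apply: BM => //; apply: BM; [exact: BV|exact: ev_B].
  - by apply: BM => //; apply: BM; [exact: BV|exact: ev_B].
  - by rewrite -pE !gnorm.
  exists k; split.
    transitivity (p' * (sgn b (c e) ^+ k * (p^-1 * ev l * p)) * sgn b (c e) ^- k / p').
      by rewrite !gnorm.
    by rewrite kE !gnorm.
  apply: leq_trans (len_c_exp _ _ _) _; apply: leq_trans (leq_mul lk (leqnn Lc)) _.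
  have l1 : len (p^-1 * ev l * p) <= 3 * (C1 * len u).
    by apply: leq_trans (len_mul3 len_len _ _ _) _; rewrite (lenV len_len); nlia.
  have l2 : len (p'^-1 * ev l' * p') <= 3 * (C1 * len v).
    by apply: leq_trans (len_mul3 len_len _ _ _) _; rewrite (lenV len_len); nlia.
  rewrite mulnDl leq_add2r.
  have := leq_mul (leq_mul (leqnn C3) (leq_add l1 l2)) (leqnn Lc).
  move/leq_trans; apply; move: (len u) (len v) Lc; clear; nia.
exists (p' * sgn b (c e) ^+ k / p); rewrite yE yE'; split=> //.
apply: leq_trans (len_mul3 len_len _ _ _) _; rewrite (lenV len_len).
have := leq_add (leq_add lp' lk) lp; move/leq_trans; apply.
by rewrite /C4; move: (len u) (len v) Lc; clear; nia.
Qed.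

End Level.
(** * Induction along the tower *)

Section Ranked.
Variables (G : groupType) (r : nat -> G) (N : nat) (xw yw : nat -> word nat).
Local Notation edge_word := (edge_word xw yw).
Hypothesis edge_below : forall e i, below i (edge_word e i).
Hypothesis r_rel : forall i, i < N -> relation_at xw yw r i.
Hypothesis r_britton : forall i, i < N -> britton_at xw yw r i.

Variable len : G -> nat.
Hypothesis len_len : is_length len.
Hypothesis len_letter : forall i, i < N -> len (r i) <= 1.
Hypothesis len_word : forall g, exists w,
  [/\ below N w, eval r w = g & size w <= len g].
Hypothesis edge_lin : forall i, i < N ->
  (forall e, eval r (edge_word e i) = 1) \/
  (forall e, lin len (eval r (edge_word e i))).

Lemma len_eval w : below N w -> len (eval r w) <= size w.
Proof.
elim: w => [|[i b] w IH] /=; first by rewrite eval_nil len1.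
case/andP=> iN /IH le; rewrite eval_cons; apply: leq_trans (lenM len_len _ _) _.
by rewrite -add1n leq_add //; case: b; rewrite /letter /= ?lenV // len_letter.
Qed.

Definition gen_word (i : nat) (g : G) (k : nat) : Prop :=
  exists w, [/\ below i w, eval r w = g & size w = k].

Definition gen_len (i : nat) (g : G) : nat := nat_min (gen_word i g).

Lemma gen_lenP i g : gen r i g -> is_min (gen_word i g) (gen_len i g).
Proof. by move=> [w wi wg]; apply: is_min_nat_min; exists (size w), w. Qed.

Lemma gen_len_eval i w : below i w -> gen_len i (eval r w) <= size w.
Proof.
move=> wi; have [|_] := @gen_lenP i (eval r w); first by exists w.
by apply; exists w.
Qed.

Lemma gen_lenM i g h : gen r i g -> gen r i h ->
  gen_len i (g * h) <= gen_len i g + gen_len i h.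
Proof.
move=> /gen_lenP [[u [ui <- <-]] _] /gen_lenP [[v [vi <- <-]] _].
by rewrite -eval_cat -size_cat gen_len_eval // below_cat ui.
Qed.

Lemma len_gen_len i g : i <= N -> gen r i g -> len g <= gen_len i g.
Proof.
move=> iN /gen_lenP [[u [ui <- <-]] _].
exact: len_eval (below_leq iN ui).
Qed.

Lemma edge_conj i e : i < N ->
  ltr (r i) e * eval r (edge_word e i) / ltr (r i) e = eval r (edge_word (~~ e) i).
Proof.
move=> iN; have := conj_subst e [:: (tt, false)] (r_rel iN).
by rewrite /word_subst /= !cats0.
Qed.

Lemma size_flat i w l : size (flat i w l) = size w + \sum_(p <- l) (size p.2).+1.
Proof.
rewrite /flat size_cat; congr (_ + _); elim: l => [|p l IH]; first by rewrite big_nil.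
by rewrite /= size_cat IH big_cons.
Qed.

Lemma cost_eval_form (mu : G -> nat) i l :
  (forall w, below i w -> mu (eval r w) <= size w) ->
  all (fun p => below i p.2) l ->
  cost mu (eval_form r l) <= \sum_(p <- l) (size p.2).+1.
Proof.
move=> mui; elim: l => [|p l IH]; first by rewrite cost_nil.
by case/andP=> pi /IH le; rewrite cost_cons big_cons leq_add // ltnS mui.
Qed.

Definition undistorted_gen (i : nat) : Prop :=
  exists C, forall g, gen r i g -> gen_len i g <= C * len g.

(* Britton reduction of a word over the next level that represents an element
   of this level removes all stable letters at linear cost. *)
Lemma undistorted_gen_down i : i < N -> undistorted_gen i.+1 -> undistorted_gen i.
Proof.
move=> iN [C CP].
have AFt := stable_ext_level edge_below (r_rel iN) (r_britton iN).
pose K0 := (size (edge_word true i) + size (edge_word false i))%N.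
have mu_c e b n : gen_len i (sgn b (eval r (edge_word e i)) ^+ n) <= n * K0.
  have -> : sgn b (eval r (edge_word e i)) ^+ n =
      eval r (word_subst (edge_word e i) (nseq n (tt, b))).
    by rewrite eval_subst; elim: n => [|n IH]; rewrite ?eval_nil // expgS IH eval_cons.
  apply: leq_trans (gen_len_eval (below_subst _ (edge_below e i))) _.
  elim: n => // n IH; rewrite /word_subst /= size_cat mulSn leq_add //.
  by rewrite /K0; case: b {IH}; case: e; rewrite ?size_inv_word ?leq_addr ?leq_addl.
have [K KP] := pinch_bound len_len (fun e => edge_conj e iN) (edge_lin iN)
  (len_letter iN) (fun a => len_gen_len (ltnW iN)) mu_c.
exists (K.+1 * C)%N => g gi.
have [[w [wi wg ws]] _] := gen_lenP (gen_leq (leqnSn i) gi).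
have {ws}wC : size w <= C * len g by rewrite ws; apply: CP; exact: gen_leq gi.
have [v [l [vi li wE]]] := word_form wi.
have gE : g = eval r v * ev (r i) (eval_form r l) by rewrite -wg wE eval_flat.
have Av : gen r i (eval r v) by exists v.
have [b [m [Ab mA ms E [le _ _]]]] := reduce AFt (@gen_lenM i) KP Av (inside_eval_form _ li).
have [_ AM AV] := gen_subgroup r i.
have gb : g = b.
  have [mN|mN] := EM (m = [::]); first by rewrite gE E mN ev_nil mulg1.
  exfalso; apply: (r_britton iN (AM _ _ (AV _ gi) Ab) mA ms mN).
  by rewrite -mulgA -E -gE mulVg.
rewrite {1}gb -mulnA; apply: leq_trans (leq_trans (leq_addr _ _) le) _.
rewrite leq_mul2l; apply/orP; right; apply: leq_trans wC.
rewrite wE size_flat leq_add ?gen_len_eval //.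
by apply: (cost_eval_form (i := i)) => // u; exact: gen_len_eval.
Qed.

(** Descending induction from the top stage, whose length is bounded by that of [G] by
    [len_word]. *)
Lemma undistorted_gen_all i : i <= N -> undistorted_gen i.
Proof.
move=> iN; rewrite -(subKn iN); elim: (N - i) => [|k IH].
  rewrite subn0; exists 1%N => g _; have [w [wN <- le]] := len_word g.
  by rewrite mul1n; apply: leq_trans (gen_len_eval wN) le.
case: (ltnP k N) => kN; last by rewrite (eqP (leqW kN : N - k.+1 == 0)) -(eqP (kN : N - k == 0)).
apply: undistorted_gen_down; first nlia.
by have -> : (N - k.+1).+1 = N - k by nlia.
Qed.

(** Both bounds go up together, since the conjugacy bound of a stage uses its rectangles; stage 0 is
    the trivial group. *)
Lemma conj_bounded_gen i : i <= N ->
  (forall x z, gen r i x -> gen r i z -> lin len x -> lin len z ->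
    rectangle len (gen r i) x z) /\ conj_bounded len (gen r i).
Proof.
elim: i => [_|i IH iN].
  have gen0 g : gen r 0 g -> g = 1 by case=> -[|//] _ <-; rewrite eval_nil.
  split=> [x z /gen0 -> _ [K /(_ 1%N)]|].
    by rewrite expg1n (len1 len_len) muln0.
  exists 0 => u v g /gen0 -> /gen0 -> _ _; exists 1.
  by rewrite invg1 !mulg1 (len1 len_len).
have [rect conj] := IH (ltnW iN).
have AFt := stable_ext_level edge_below (r_rel iN) (r_britton iN).
have [C CP] := undistorted_gen_all iN.
have form_B a l : gen r i a -> inside (gen r i) l -> gen r i.+1 (a * ev (r i) l).
  move=> [v vi <-] /inside_gen [m mi ->]; exists (flat i v m).
    exact: below_flat.
  exact: eval_flat.
have B_form g : gen r i.+1 g -> exists a l, [/\ gen r i a, inside (gen r i) l,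
    g = a * ev (r i) l & len a + cost len l <= C * len g].
  move=> gi; have [[w [wi wg ws]] _] := gen_lenP gi.
  have [v [l [vi li wE]]] := word_form wi.
  exists (eval r v), (eval_form r l); split.
  - by exists v.
  - exact: inside_eval_form.
  - by rewrite -wg wE eval_flat.
  apply: leq_trans (CP _ gi); rewrite -ws wE size_flat.
  have lw u : below i u -> len (eval r u) <= size u.
    by move=> ui; apply/len_eval/(below_leq (ltnW iN)).
  by apply: leq_add; [exact: lw|exact: cost_eval_form lw li].
have Bsub := gen_subgroup r i.+1.
split.
  exact: (rectangle_ext len_len AFt Bsub (fun e => edge_conj e iN) (edge_lin iN)
    (len_letter iN) form_B B_form rect).
exact: (conj_bounded_ext len_len AFt Bsub (fun e => edge_conj e iN) (edge_lin iN)
    (len_letter iN) form_B B_form rect conj).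
Qed.

End Ranked.
Lemma presented_eq_eval (X I : Type) (l r : I -> word X) (K : groupType)
    (s : X -> K) u v :
  (forall i, eval s (l i) = eval s (r i)) -> presented_eq l r u v ->
  eval s u = eval s v.
Proof.
move=> rel; elim=> {u v} [u v []|//|u v _ ->|u v w _ -> _ ->] //.
- move=> {}u a {}v; rewrite !eval_cat eval_cons eval_seq1.
  by case: a => a []; rewrite /letter /= ?mulVg ?mulgV mul1g.
- by move=> {}u i {}v; rewrite !eval_cat rel.
Qed.

(** * The group of the theorem *)

Section WordLength.
Variables (X : finType) (G : groupType) (s : X -> G).
Hypothesis s_gen : forall g, generated s g.

Lemma word_length_word g : exists w, eval s w = g /\ size w = word_length s g.
Proof. by case: (word_lengthP (s_gen g)). Qed.

Lemma word_length_eval w : word_length s (eval s w) <= size w.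
Proof. by case: (word_lengthP (s_gen (eval s w))) => _; apply; exists w. Qed.

Lemma is_length_word_length : is_length (word_length s).
Proof.
split=> [|g|g h|g]; first exact: word_length1.
- by have [w [<- <-]] := word_length_word g => /size0nil ->; rewrite eval_nil.
- have [u [<- <-]] := word_length_word g; have [v [<- <-]] := word_length_word h.
  by rewrite -eval_cat -size_cat word_length_eval.
have leV k : word_length s k^-1 <= word_length s k.
  have [u [<- <-]] := word_length_word k.
  by rewrite -eval_inv_word -size_inv_word word_length_eval.
by apply/eqP; rewrite eqn_leq leV -{1}[g]invgK leV.
Qed.

Lemma undistorted_lin g : (forall n, 0 < n -> g ^+ n <> 1) ->
  cyclic_undistorted s g -> lin (word_length s) g.
Proof.
move=> g_tf [[C [_ dist]] _].
have cyc_len n : n <= word_length (fun _ : unit => g) (g ^+ n).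
  have gn : generated (fun _ : unit => g) (g ^+ n).
    by apply/cycP; exists false, n.
  have [[w [wE <-]] _] := word_lengthP gn.
  have [b [m [mw E]]] := unit_word_exp w; rewrite E in wE.
  rewrite leqNgt; apply/negP => lt; have {lt}mn := leq_ltn_trans mw lt.
  case: b E wE => _ /= wE.
    apply: (g_tf (m + n)); first by rewrite addn_gt0 (leq_ltn_trans _ mn) ?orbT.
    by rewrite expgnDr -wE expVgn mulgV.
  apply: (g_tf (n - m)); first by rewrite subn_gt0.
  by rewrite expgnFr -?wE ?mulgV // ltnW.
(* A nontrivial element has length at least 1, so doubling absorbs the additive constant. *)
exists (2 * (C * C + C))%N => -[|n] //.
have [_ /(_ _ _) maxd] := distortionP (fun _ : unit => g) (word_length s (g ^+ n.+1)) s_gen.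
apply: leq_trans (cyc_len _) _.
apply: leq_trans (maxd _ _) (leq_trans (dist _) _).
  by exists (g ^+ n.+1); split=> //; apply/cycP; exists false, n.+1.
have : word_length s (g ^+ n.+1) <> 0.
  by move/(len_eq0 is_length_word_length); exact: g_tf.
by move: (word_length _ _) => k; rewrite /=; clear; nia.
Qed.

End WordLength.

(** * Ranking the generators by natural numbers *)

Section Ranking.
Variables (L : finType) (M : nat).
Local Notation X := (L + 'I_M)%type.

(** The letters of [L] come first, so that the letters allowed in [x j] and [y j] all rank below the
    stable letter [inr j]. *)
Definition rank (a : X) : nat :=
  match a with inl b => enum_rank b | inr j => #|L| + j end.

Definition ranked_word (w : word X) : word nat := [seq (rank a.1, a.2) | a <- w].

(* A letter of L gets the trivial relation a 1 a^-1 = 1. *)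
Definition ranked_relator (x : 'I_M -> word X) (i : nat) : word nat :=
  if [pick j : 'I_M | #|L| + j == i] is Some j then ranked_word (x j) else [::].

Lemma rank_lt a : rank a < #|L| + M.
Proof. by case: a => [b|j] /=; rewrite ?ltn_add2l // ltn_addr. Qed.

Lemma rank_onto i : i < #|L| + M -> exists a, rank a = i.
Proof.
case: (ltnP i #|L|) => [iL _|Li iM]; first by exists (inl (enum_val (Ordinal iL))); rewrite /= enum_valK.
have jM : i - #|L| < M by nlia.
by exists (inr (Ordinal jM)); rewrite /= subnKC.
Qed.

Lemma rank_inj : injective rank.
Proof.
move=> [a|j] [b|k] /=.
- by move/ord_inj/enum_rank_inj ->.
- by move=> E; have := ltn_ord (enum_rank a); rewrite E ltnNge leq_addr.
- by move=> E; have := ltn_ord (enum_rank b); rewrite -E ltnNge leq_addr.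
- by move/addnI/ord_inj ->.
Qed.

Lemma ranked_relator_rank x (j : 'I_M) : ranked_relator x (#|L| + j) = ranked_word (x j).
Proof.
rewrite /ranked_relator; case: pickP => [k /eqP /addnI /ord_inj -> //|/(_ j)].
by rewrite eqxx.
Qed.

Lemma ranked_relator_cases x i :
  ranked_relator x i = [::] \/ exists j : 'I_M, i = #|L| + j.
Proof.
rewrite /ranked_relator; case: pickP => [j /eqP <-|_]; [right|by left].
by exists j.
Qed.

Lemma ranked_word_below w : below (#|L| + M) (ranked_word w).
Proof. by elim: w => //= a w IH; rewrite rank_lt. Qed.

Lemma ranked_word_onto u : below (#|L| + M) u -> exists w, ranked_word w = u.
Proof.
elim: u => [|[i b] u IH] /=; first by exists [::].
case/andP=> /rank_onto [a <-] /IH [w <-]; by exists ((a, b) :: w).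
Qed.

Lemma eval_ranked (G : groupType) (r : nat -> G) w :
  eval r (ranked_word w) = eval (r \o rank) w.
Proof.
elim: w => [|a w IH] /=; first by rewrite !eval_nil.
by rewrite !eval_cons IH.
Qed.

Lemma ranked_relator_below x i : (forall j, word_below j (x j)) ->
  below i (ranked_relator x i).
Proof.
move=> xb; case: (ranked_relator_cases x i) => [-> //|[j ->]].
rewrite ranked_relator_rank; move: (xb j); rewrite /word_below.
elim: (x j) => //= -[a b] w IH /andP[aj /IH ->]; rewrite andbT.
by case: a aj => [a _|k kj] /=; rewrite ?ltn_add2l // ltn_addr.
Qed.

End Ranking.

Theorem theorem1 (G : groupType) (L : finType) (M : nat) (s : L + 'I_M -> G)
    (x y : 'I_M -> word (L + 'I_M))
    (hpres : has_presentation s (fun i => stable_conj i (x i)) y)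
    (hbelow : forall i, word_below i (x i) /\ word_below i (y i))
    (hneq1 : forall i, eval s (x i) <> 1%g /\ eval s (y i) <> 1%g)
    (hfree : free_basis (fun a : L => s (inl a)))
    (hundist : forall i, cyclic_undistorted s (eval s (x i)) /\
                         cyclic_undistorted s (eval s (y i))) :
  simeq (conjugator_length s) id.
Proof.
case: hpres => s_gen s_eq; pose N := (#|L| + M)%N.
pose r i : G := if [pick a | rank a == i] is Some a then s a else 1.
have rE a : r (rank a) = s a.
  rewrite /r; case: pickP => [b /eqP /rank_inj -> //|/(_ a)].
  by rewrite eqxx.
have rwE w : eval r (ranked_word w) = eval s w.
  by rewrite eval_ranked; congr (eval _ _); apply/funext => a; exact: rE.
pose xw := ranked_relator x; pose yw := ranked_relator y.
have edge_below e i : below i (edge_word xw yw e i).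
  by case: e; apply: ranked_relator_below => j; case: (hbelow j).
have xy_cases i : (xw i = [::] /\ yw i = [::]) \/
    exists j : 'I_M, [/\ i = (#|L| + j)%N, xw i = ranked_word (x j) & yw i = ranked_word (y j)].
  have [xN|[j ->]] := ranked_relator_cases x i; last first.
    by right; exists j; rewrite /xw /yw !ranked_relator_rank.
  have [yN|[j ->]] := ranked_relator_cases y i; first by left.
  by right; exists j; rewrite /xw /yw !ranked_relator_rank.
have eval_conj (K : groupType) (q : L + 'I_M -> K) j w :
    eval q (stable_conj j w) = q (inr j) * eval q w / q (inr j).
  by rewrite /stable_conj eval_cons eval_cat eval_seq1 /letter /= mulgA.
have r_rel i : i < N -> relation_at xw yw r i.
  move=> _; rewrite /relation_at.
  have [[-> ->]|[j [-> -> ->]]] := xy_cases i; first by rewrite eval_nil mulg1 mulgV.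
  rewrite !rwE (rE (inr j)) -eval_conj; apply/s_eq; apply: PresStep.
  by have := ApplyRelation (fun i => stable_conj i (x i)) y [::] j [::]; rewrite !cats0.
have r_edge i : i < N -> (xw i = [::] /\ yw i = [::]) \/
    (eval r (xw i) <> 1 /\ eval r (yw i) <> 1).
  move=> _; have [|[j [_ -> ->]]] := xy_cases i; first by left.
  by right; rewrite !rwE.
(* The presentation enters here: a trivial word is a consequence of the relations, which hold in
   [K]. *)
have r_univ w : below N w -> eval r w = 1 -> forall (K : groupType) (q : nat -> K),
    (forall i, i < N -> relation_at xw yw q i) -> eval q w = 1.
  move=> /ranked_word_onto [v <-]; rewrite rwE -(eval_nil s) => /s_eq E K q q_rel.
  rewrite eval_ranked -(eval_nil (q \o @rank L M)).
  apply: (presented_eq_eval _ E) => j; rewrite eval_conj -!eval_ranked.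
  have := q_rel (#|L| + j)%N; rewrite /relation_at /xw /yw !ranked_relator_rank.
  by apply; rewrite ltn_add2l.
have r_brit := britton_presented edge_below r_rel r_edge r_univ.
have gen_r g : gen r N g.
  have [w <-] := s_gen g; exists (ranked_word w); last exact: rwE.
  exact: ranked_word_below.
have tf g n := torsion_free_presented edge_below r_rel r_edge r_univ (n := n) (gen_r g).
have len_len := is_length_word_length s_gen.
have len_letter i : i < N -> word_length s (r i) <= 1.
  move=> /rank_onto [a <-]; rewrite rE.
  by have := word_length_eval s_gen [:: (a, false)]; rewrite eval_seq1.
have len_word g : exists w, [/\ below N w, eval r w = g & size w <= word_length s g].
  have [w [wg ws]] := word_length_word s_gen g; exists (ranked_word w).
  by split; [exact: ranked_word_below|rewrite rwE|rewrite size_map ws].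
have edge_lin i : i < N -> (forall e, eval r (edge_word xw yw e i) = 1) \/
    (forall e, lin (word_length s) (eval r (edge_word xw yw e i))).
  move=> _; have [[xN yN]|[j [_ xE yE]]] := xy_cases i.
    by left; case; rewrite /edge_word ?xN ?yN eval_nil.
  have [x1 y1] := hneq1 j; have [xu yu] := hundist j.
  by right; case; rewrite /edge_word ?xE ?yE rwE; apply: undistorted_lin => // n n0 /tf;
    move/(_ n0).
have [_ [C CP]] := conj_bounded_gen edge_below r_rel r_brit len_len len_letter
  len_word edge_lin (leqnn N).
(* The linear term in the definition of [preceq] gives the lower bound at once. *)
split; last by exists 1%N; split=> // n; rewrite mul1n /=; nlia.
exists C.+1; split=> // n.
have [[u [v [[g E] uv cuv]]] _] := conjugator_lengthP n s_gen.
have [d [dE ld]] := CP _ _ _ (gen_r u) (gen_r v) (gen_r g) E.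
have [_ cmin] := conjugator_distP s (ex_intro _ g E).
rewrite -cuv; apply: leq_trans (cmin (word_length s d) _) _; first by exists d.
apply: leq_trans ld _; rewrite /=.
have : C * (word_length s u + word_length s v) <= C * n by rewrite leq_mul2l uv orbT.
by move: (C * (_ + _))%N => k; clear; nia.
Qed.
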